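(* Let $\mathtt{P}$ and $\mathtt{Q}$ be finite $\pi$-calculus processes and $\bar n$ the free names of $\mathtt{P}$ and $\mathtt{Q}$. Then $\forall\bar n.\,\mathrm{lbisim}\,[\![\mathtt{P}]\!]\,[\![\mathtt{Q}]\!]$ is provable in $FO\lambda^{\Delta\nabla}$ if and only if $\forall\bar n.\,\mathrm{ebisim}\,[\![\mathtt{P}]\!]\,[\![\mathtt{Q}]\!]$ is provable in $FO\lambda^{\Delta\nabla}$ (both with respect to the definition $\mathbf{D}_\pi$ together with the $\mathrm{lbisim}$ and $\mathrm{ebisim}$ clauses, and with no further assumptions).
   Context: $FO\lambda^{\Delta\nabla}$ (Miller–Tiu): intuitionistic sequent calculus over simply typed $\lambda$-terms with $\top,\bot,\land,\lor,\supset,\forall,\exists$ and $\nabla$ (introduced on both sides via fresh locally scoped variables), raised eigenvariables, and stratified definitions with defR (unfolding) and defL (case analysis over complete sets of unifiers with clause heads); equality $x=x\triangleq\top$. Encoding of finite $\pi$-calculus processes (names as variables of type $n$, no constants): $[\![\cdot]\!]$ maps $0,+,|,\tau.$ to constants, $[x=y]\mathtt{P}\mapsto\mathrm{match}\,x\,y[\![\mathtt{P}]\!]$, $\bar xy.\mathtt{P}\mapsto\mathrm{out}\,x\,y[\![\mathtt{P}]\!]$, $x(y).\mathtt{P}\mapsto\mathrm{in}\,x(\lambda y.[\![\mathtt{P}]\!])$, $(x)\mathtt{P}\mapsto\nu(\lambda x.[\![\mathtt{P}]\!])$. $\mathbf{D}_\pi$ defines $\mathrm{one}:p\to a\to p\to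 o$, $\mathrm{onep}:p\to(n\to a)\to(n\to p)\to o$ (actions $\tau:a$, $\downarrow,\uparrow:n\to n\to a$) by: $\mathrm{one}(\tau P)\tau P\triangleq\top$; $\mathrm{onep}(\mathrm{in}XM)(\downarrow X)M\triangleq\top$; $\mathrm{one}(\mathrm{out}\,x\,y\,P)(\uparrow xy)P\triangleq\top$; $\mathrm{one}(\mathrm{match}\,x\,x\,P)AQ\triangleq\mathrm{one}PAQ$ (also onep); $\mathrm{one}(P+Q)AR\triangleq\mathrm{one}PAR$, $\triangleq\mathrm{one}QAR$ (also onep); $\mathrm{one}(P|Q)A(P'|Q)\triangleq\mathrm{one}PAP'$; $\mathrm{one}(P|Q)A(P|Q')\triangleq\mathrm{one}QAQ'$; $\mathrm{onep}(P|Q)A(\lambda n.(Mn|Q))\triangleq\mathrm{onep}PAM$; $\mathrm{onep}(P|Q)A(\lambda n.(P|Nn))\triangleq\mathrm{onep}QAN$; $\mathrm{one}(\nu\lambda n.Pn)A(\nu\lambda n.Qn)\triangleq\nabla n.\mathrm{one}(Pn)A(Qn)$; $\mathrm{onep}(\nu\lambda n.Pn)A(\lambda m.\nu\lambda n.P'nm)\triangleq\nabla n.\mathrm{onep}(Pn)A(P'n)$; $\mathrm{onep}(\nu\lambda n.Mn)(\uparrow X)M'\triangleq\nabla n.\mathrm{one}(Mn)(\uparrow Xn)(M'n)$; $\mathrm{one}(P|Q)\tau(\nu\lambda n.(Mn|Nn))\triangleq\exists X.\mathrm{onep}P(\downarrow X)M\land\mathrm{onep}Q(\uparrow X)N$ and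 with $\uparrow,\downarrow$ swapped; $\mathrm{one}(P|Q)\tau(MY|Q')\triangleq\exists X.\mathrm{onep}P(\downarrow X)M\land\mathrm{one}Q(\uparrow XY)Q'$; $\mathrm{one}(P|Q)\tau(P'|NY)\triangleq\exists X.\mathrm{one}P(\uparrow XY)P'\land\mathrm{onep}Q(\downarrow X)N$. $\mathrm{lbisim}PQ\triangleq$ conjunction of $\forall A\forall P'[\mathrm{one}PAP'\supset\exists Q'.\mathrm{one}QAQ'\land\mathrm{lbisim}P'Q']$, $\forall X\forall P'[\mathrm{onep}P(\downarrow X)P'\supset\exists Q'.\mathrm{onep}Q(\downarrow X)Q'\land\forall w.\mathrm{lbisim}(P'w)(Q'w)]$, $\forall X\forall P'[\mathrm{onep}P(\uparrow X)P'\supset\exists Q'.\mathrm{onep}Q(\uparrow X)Q'\land\nabla w.\mathrm{lbisim}(P'w)(Q'w)]$, and the three symmetric conjuncts with $P,Q$ swapped. $\mathrm{ebisim}$ is defined by the same clause with $\mathrm{ebisim}$ in place of $\mathrm{lbisim}$, except that the two input conjuncts are $\forall X\forall P'[\mathrm{onep}P(\downarrow X)P'\supset\forall w\exists Q'.\mathrm{onep}Q(\downarrow X)Q'\land\mathrm{ebisim}(P'w)(Q'w)]$ and its symmetric version. *)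

(* Defs.v *)
(* Rocq's standard library only.  Terms are intrinsically typed, with
   de Bruijn variables, so that alpha-equivalence is syntactic identity. *)
From Stdlib Require Export List Permutation.
From Stdlib Require Fin.
Export ListNotations.
Set Implicit Arguments.
Unset Printing Implicit Defensive.

(* Names, processes and actions.  The type o of formulas is not a [ty], hence
   quantification over types that contain o is excluded. *)
Inductive ty : Set :=
| tn : ty
| tp : ty
| ta : ty
| arr : ty -> ty -> ty.

Declare Scope fold_scope.
Open Scope fold_scope.

Notation "a ~> b" := (arr a b) (at level 55, right associativity) : fold_scope.

(* The head of a context is its most recently introduced variable. *)
Definition ctx := list ty.

Inductive var : ctx -> ty -> Type :=
| vz : forall G t, var (t :: G) t
| vs : forall G t u, var G t -> var (u :: G) t.
Arguments vz {G t}.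
Arguments vs {G t u} x.

(* There is no constant of type [tn]. *)
Inductive cst : ty -> Type :=
| c_nil : cst tp
| c_tau : cst (tp ~> tp)
| c_plus : cst (tp ~> tp ~> tp)
| c_par : cst (tp ~> tp ~> tp)
| c_match : cst (tn ~> tn ~> tp ~> tp)
| c_out : cst (tn ~> tn ~> tp ~> tp)
| c_in : cst (tn ~> (tn ~> tp) ~> tp)
| c_nu : cst ((tn ~> tp) ~> tp)
| c_atau : cst ta
| c_dn : cst (tn ~> tn ~> ta)
| c_up : cst (tn ~> tn ~> ta).

Inductive tm (G : ctx) : ty -> Type :=
| tvar : forall t, var G t -> tm G t
| tcst : forall t, cst t -> tm G t
| tapp : forall a b, tm G (a ~> b) -> tm G a -> tm G b
| tlam : forall a b, tm (a :: G) b -> tm G (a ~> b).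
Arguments tvar {G t} x.
Arguments tcst {G t} c.
Arguments tapp {G a b} M N.
Arguments tlam {G a b} M.

Notation "M ⋅ N" := (tapp M N) (at level 25, left associativity) : fold_scope.

Definition ren (G D : ctx) := forall t, var G t -> var D t.
Definition sub (G D : ctx) := forall t, var G t -> tm D t.

Definition up_ren G D a (r : ren G D) : ren (a :: G) (a :: D) :=
  fun t x =>
    match x in var H u
      return match H with [] => Empty_set | b :: H' => ren H' D -> var (b :: D) u end
    with
    | vz => fun _ => vz
    | vs y => fun r => vs (r _ y)
    end r.
Arguments up_ren {G D a} r t x.

Fixpoint tren G D t (r : ren G D) (M : tm G t) : tm D t :=
  match M with
  | tvar x => tvar (r _ x)
  | tcst c => tcst c
  | tapp M N => tapp (tren r M) (tren r N)
  | tlam M => tlam (tren (up_ren r) M)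
  end.

Definition wk G a t (M : tm G t) : tm (a :: G) t := tren (fun _ x => vs x) M.
Arguments wk {G a t} M.
Notation "⇑ M" := (wk M) (at level 9, M at level 9, right associativity) : fold_scope.

Definition scons G D a (N : tm D a) (s : sub G D) : sub (a :: G) D :=
  fun t x =>
    match x in var H u
      return match H with [] => Empty_set | b :: H' => tm D b -> sub H' D -> tm D u end
    with
    | vz => fun N _ => N
    | vs y => fun _ s => s _ y
    end N s.

Definition idsub G : sub G G := fun _ x => tvar x.
Definition wksub G a : sub G (a :: G) := fun _ x => tvar (vs x).
Definition up G D a (s : sub G D) : sub (a :: G) (a :: D) :=
  scons (tvar vz) (fun _ x => ⇑(s _ x)).
Arguments up {G D a} s t x.

(* Lifting of a substitution under the local signature [l]. *)
Fixpoint lifts G D (l : ctx) (s : sub G D) : sub (l ++ G) (l ++ D) :=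
  match l return sub (l ++ G) (l ++ D) with
  | [] => s
  | a :: l' => up (lifts l' s)
  end.

Fixpoint tsub G D t (s : sub G D) (M : tm G t) : tm D t :=
  match M with
  | tvar x => s _ x
  | tcst c => tcst c
  | tapp M N => tapp (tsub s M) (tsub s N)
  | tlam M => tlam (tsub (up s) M)
  end.

Definition scomp G D E (s : sub G D) (r : sub D E) : sub G E :=
  fun _ x => tsub r (s _ x).

(* Beta-eta-convertibility. *)
Inductive conv : forall G t, tm G t -> tm G t -> Prop :=
| conv_refl : forall G t (M : tm G t), conv M M
| conv_sym : forall G t (M N : tm G t), conv M N -> conv N M
| conv_trans : forall G t (M N K : tm G t), conv M N -> conv N K -> conv M K
| conv_app : forall G a b (M M' : tm G (a ~> b)) (N N' : tm G a),
    conv M M' -> conv N N' -> conv (M ⋅ N) (M' ⋅ N')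
| conv_lam : forall G a b (M M' : tm (a :: G) b),
    conv M M' -> conv (tlam M) (tlam M')
| conv_beta : forall G a b (M : tm (a :: G) b) (N : tm G a),
    conv (tlam M ⋅ N) (tsub (scons N (@idsub G)) M)
| conv_eta : forall G a b (M : tm G (a ~> b)),
    conv M (tlam (⇑M ⋅ tvar vz)).

Definition sconv G D (s r : sub G D) := forall t (x : var G t), conv (s t x) (r t x).

Inductive atom (G : ctx) : Type :=
| one : tm G tp -> tm G ta -> tm G tp -> atom G
| onep : tm G tp -> tm G (tn ~> ta) -> tm G (tn ~> tp) -> atom G
| lbisim : tm G tp -> tm G tp -> atom G
| ebisim : tm G tp -> tm G tp -> atom G
| equal : forall t, tm G t -> tm G t -> atom G.

Inductive form (G : ctx) : Type :=
| fatom : atom G -> form G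
| ftop : form G
| fbot : form G
| fand : form G -> form G -> form G
| for_ : form G -> form G -> form G
| fimp : form G -> form G -> form G
| fall : forall t, form (t :: G) -> form G
| fex : forall t, form (t :: G) -> form G
| fnab : forall t, form (t :: G) -> form G.
Arguments ftop {G}.
Arguments fbot {G}.

Coercion fatom : atom >-> form.
Notation "A ⊓ B" := (fand A B) (at level 80, right associativity) : fold_scope.
Notation "A ⊃ B" := (fimp A B) (at level 86, right associativity) : fold_scope.

Definition asub G D (s : sub G D) (A : atom G) : atom D :=
  match A with
  | one P A Q => one (tsub s P) (tsub s A) (tsub s Q)
  | onep P A M => onep (tsub s P) (tsub s A) (tsub s M)
  | lbisim P Q => lbisim (tsub s P) (tsub s Q)
  | ebisim P Q => ebisim (tsub s P) (tsub s Q)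
  | equal M N => equal (tsub s M) (tsub s N)
  end.

Fixpoint fsub G D (s : sub G D) (B : form G) : form D :=
  match B with
  | fatom A => fatom (asub s A)
  | ftop => ftop
  | fbot => fbot
  | fand B C => fand (fsub s B) (fsub s C)
  | for_ B C => for_ (fsub s B) (fsub s C)
  | fimp B C => fimp (fsub s B) (fsub s C)
  | fall B => fall (fsub (up s) B)
  | fex B => fex (fsub (up s) B)
  | fnab B => fnab (fsub (up s) B)
  end.

Inductive aconv G : atom G -> atom G -> Prop :=
| aconv_one : forall P P' A A' Q Q',
    conv P P' -> conv A A' -> conv Q Q' -> aconv (one P A Q) (one P' A' Q')
| aconv_onep : forall P P' A A' M M',
    conv P P' -> conv A A' -> conv M M' -> aconv (onep P A M) (onep P' A' M')
| aconv_lbisim : forall P P' Q Q',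
    conv P P' -> conv Q Q' -> aconv (lbisim P Q) (lbisim P' Q')
| aconv_ebisim : forall P P' Q Q',
    conv P P' -> conv Q Q' -> aconv (ebisim P Q) (ebisim P' Q')
| aconv_equal : forall t (M M' N N' : tm G t),
    conv M M' -> conv N N' -> aconv (equal M N) (equal M' N').

Inductive fconv : forall G, form G -> form G -> Prop :=
| fconv_atom : forall G (A A' : atom G), aconv A A' -> fconv A A'
| fconv_top : forall G, fconv (@ftop G) ftop
| fconv_bot : forall G, fconv (@fbot G) fbot
| fconv_and : forall G (B B' C C' : form G),
    fconv B B' -> fconv C C' -> fconv (fand B C) (fand B' C')
| fconv_or : forall G (B B' C C' : form G),
    fconv B B' -> fconv C C' -> fconv (for_ B C) (for_ B' C')
| fconv_imp : forall G (B B' C C' : form G),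
    fconv B B' -> fconv C C' -> fconv (fimp B C) (fimp B' C')
| fconv_all : forall G t (B B' : form (t :: G)), fconv B B' -> fconv (fall B) (fall B')
| fconv_ex : forall G t (B B' : form (t :: G)), fconv B B' -> fconv (fex B) (fex B')
| fconv_nab : forall G t (B B' : form (t :: G)), fconv B B' -> fconv (fnab B) (fnab B').

(* Judgments over the global signature [S]. *)
Record jdg (S : ctx) : Type := Jdg { jloc : ctx; jform : form (jloc ++ S) }.
Notation "l ▷ B" := (@Jdg _ l B) (at level 88, no associativity) : fold_scope.

Definition jsub S S' (s : sub S S') (J : jdg S) : jdg S' :=
  jloc J ▷ fsub (lifts (jloc J) s) (jform J).

Definition jconv S (J K : jdg S) : Prop :=
  exists l (B C : form (l ++ S)), J = (l ▷ B) /\ K = (l ▷ C) /\ fconv B C.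

(* [raise [am; ..; a1] t] is a1 -> .. -> am -> t. *)
Fixpoint raise (l : ctx) (t : ty) : ty :=
  match l with
  | [] => t
  | a :: l' => raise l' (a ~> t)
  end.

Fixpoint inl_var l G t (x : var l t) : var (l ++ G) t :=
  match x in var l t return var (l ++ G) t with
  | vz => vz
  | vs y => vs (inl_var G y)
  end.

Fixpoint inr_var l G t (x : var G t) : var (l ++ G) t :=
  match l return var (l ++ G) t with
  | [] => x
  | a :: l' => vs (inr_var l' x)
  end.

Fixpoint spine G l t (s : sub l G) (h : tm G (raise l t)) {struct l} : tm G t :=
  match l return sub l G -> forall t, tm G (raise l t) -> tm G t with
  | [] => fun _ _ h => h
  | a :: l' => fun s t h => spine (a ~> t) (fun _ x => s _ (vs x)) h ⋅ s _ vz
  end s t h.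
Arguments spine {G l t} s h.

(* For h : raise l t in [G], the term h y1 .. ym over the local signature
   l = [ym; ..; y1]. *)
Definition app_loc l G t (h : var G (raise l t)) : tm (l ++ G) t :=
  spine (fun _ x => tvar (inl_var G x)) (tvar (inr_var l h)).
Arguments app_loc l {G t} h.

(* The instance B[(h l)/x], where h is a fresh eigenvariable. *)
Definition eigen S l t (B : form (t :: l ++ S)) : form (l ++ raise l t :: S) :=
  fsub (scons (app_loc l (vz : var (raise l t :: S) (raise l t)))
              (lifts l (@wksub S (raise l t)))) B.
Arguments eigen {S} l {t} B.

Definition inst G t (B : form (t :: G)) (N : tm G t) : form G :=
  fsub (scons N (@idsub G)) B.

(* A clause "forall xs. head := body". *)
Record clause : Type := Clause {
  cl_vars : ctx;
  cl_head : atom cl_vars;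
  cl_body : form cl_vars }.

Definition definition := clause -> Prop.

Definition raised (l xs : ctx) : ctx := map (raise l) xs.

Fixpoint raise_var l xs t (x : var xs t) : var (raised l xs) (raise l t) :=
  match x in var xs t return var (raised l xs) (raise l t) with
  | vz => vz
  | vs y => vs (raise_var l y)
  end.

(* The raising substitution x |-> h l. *)
Definition raise_sub l xs : sub xs (l ++ raised l xs) :=
  fun _ x => app_loc l (raise_var l x).

Definition raised_head l (c : clause) : atom (l ++ raised l (cl_vars c)) :=
  asub (@raise_sub l (cl_vars c)) (cl_head c).

Definition raised_body l (c : clause) : form (l ++ raised l (cl_vars c)) :=
  fsub (@raise_sub l (cl_vars c)) (cl_body c).

(* A substitution on the disjoint union of the global signature [S] and of the
   variables of the clause [c] raised over [l], with values over [S'], is a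
   pair of substitutions. *)
Definition unifier S l (A : atom (l ++ S)) (c : clause) S'
    (s : sub S S') (r : sub (raised l (cl_vars c)) S') : Prop :=
  aconv (asub (lifts l s) A) (asub (lifts l r) (raised_head l c)).
Arguments unifier {S} l A c {S'} s r.

Definition subst_set S l (c : clause) : Type :=
  forall S', sub S S' -> sub (raised l (cl_vars c)) S' -> Prop.

(* [U] is a complete set of unifiers of l ▷ A and of the raised head of [c]. *)
Definition csu S l (A : atom (l ++ S)) (c : clause) (U : subst_set S l c) : Prop :=
  (forall S' s r, U S' s r -> unifier l A c s r) /\
  (forall S'' (s' : sub S S'') (r' : sub (raised l (cl_vars c)) S''),
     unifier l A c s' r' ->
     exists S' (s : sub S S') (r : sub (raised l (cl_vars c)) S') (d : sub S' S''),
       U S' s r /\ sconv s' (scomp s d) /\ sconv r' (scomp r d)).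
Arguments csu {S} l A c U.

(* [der D S Gam J] : the sequent S ; Gam |- J is derivable with definition [D].
   Antecedents are multisets ([d_perm]) and formulas are identified up to
   beta-eta-conversion ([d_convL], [d_convR]).  Cut is a rule of the calculus,
   and [d_defL] has infinitely many premises when the set of unifiers is
   infinite. *)
Inductive der (D : definition) : forall S : ctx, list (jdg S) -> jdg S -> Prop :=
| d_init : forall S Gam (J : jdg S), der D (J :: Gam) J
| d_cut : forall S Del Gam (J K : jdg S),
    der D Del J -> der D (J :: Gam) K -> der D (Del ++ Gam) K
| d_perm : forall S Gam Gam' (J : jdg S),
    Permutation Gam Gam' -> der D Gam J -> der D Gam' J
| d_convL : forall S Gam (J J' K : jdg S),
    jconv J J' -> der D (J :: Gam) K -> der D (J' :: Gam) K
| d_convR : forall S Gam (J J' : jdg S),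
    jconv J J' -> der D Gam J -> der D Gam J'
| d_weak : forall S Gam (J K : jdg S), der D Gam K -> der D (J :: Gam) K
| d_contr : forall S Gam (J K : jdg S), der D (J :: J :: Gam) K -> der D (J :: Gam) K
| d_topR : forall S Gam l, der D Gam (l ▷ (ftop : form (l ++ S)))
| d_botL : forall S Gam l (K : jdg S), der D ((l ▷ fbot) :: Gam) K
| d_andL : forall S Gam l (B C : form (l ++ S)) (K : jdg S),
    der D ((l ▷ B) :: (l ▷ C) :: Gam) K -> der D ((l ▷ fand B C) :: Gam) K
| d_andR : forall S (Gam : list (jdg S)) l (B C : form (l ++ S)),
    der D Gam (l ▷ B) -> der D Gam (l ▷ C) -> der D Gam (l ▷ fand B C)
| d_orL : forall S Gam l (B C : form (l ++ S)) (K : jdg S),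
    der D ((l ▷ B) :: Gam) K -> der D ((l ▷ C) :: Gam) K ->
    der D ((l ▷ for_ B C) :: Gam) K
| d_orR1 : forall S (Gam : list (jdg S)) l (B C : form (l ++ S)),
    der D Gam (l ▷ B) -> der D Gam (l ▷ for_ B C)
| d_orR2 : forall S (Gam : list (jdg S)) l (B C : form (l ++ S)),
    der D Gam (l ▷ C) -> der D Gam (l ▷ for_ B C)
| d_impL : forall S Gam l (B C : form (l ++ S)) (K : jdg S),
    der D Gam (l ▷ B) -> der D ((l ▷ C) :: Gam) K ->
    der D ((l ▷ fimp B C) :: Gam) K
| d_impR : forall S (Gam : list (jdg S)) l (B C : form (l ++ S)),
    der D ((l ▷ B) :: Gam) (l ▷ C) -> der D Gam (l ▷ fimp B C)
| d_allL : forall S Gam l t (B : form (t :: l ++ S)) (N : tm (l ++ S) t) (K : jdg S),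
    der D ((l ▷ inst B N) :: Gam) K -> der D ((l ▷ fall B) :: Gam) K
| d_allR : forall S (Gam : list (jdg S)) l t (B : form (t :: l ++ S)),
    der D (map (jsub (@wksub S (raise l t))) Gam) (l ▷ eigen l B) ->
    der D Gam (l ▷ fall B)
| d_exL : forall S Gam l t (B : form (t :: l ++ S)) (K : jdg S),
    der D ((l ▷ eigen l B) :: map (jsub (@wksub S (raise l t))) Gam)
          (jsub (@wksub S (raise l t)) K) ->
    der D ((l ▷ fex B) :: Gam) K
| d_exR : forall S (Gam : list (jdg S)) l t (B : form (t :: l ++ S)) (N : tm (l ++ S) t),
    der D Gam (l ▷ inst B N) -> der D Gam (l ▷ fex B)
| d_nabL : forall S Gam l t (B : form (t :: l ++ S)) (K : jdg S),
    der D ((t :: l ▷ B) :: Gam) K -> der D ((l ▷ fnab B) :: Gam) K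
| d_nabR : forall S (Gam : list (jdg S)) l t (B : form (t :: l ++ S)),
    der D Gam (t :: l ▷ B) -> der D Gam (l ▷ fnab B)
| d_defL : forall S Gam l (A : atom (l ++ S)) (K : jdg S)
      (U : forall c, subst_set S l c),
    (forall c, D c -> csu l A c (U c)) ->
    (forall c, D c -> forall S' (s : sub S S') (r : sub (raised l (cl_vars c)) S'),
       U c S' s r ->
       der D ((l ▷ fsub (lifts l r) (raised_body l c)) :: map (jsub s) Gam) (jsub s K)) ->
    der D ((l ▷ fatom A) :: Gam) K
| d_defR : forall S (Gam : list (jdg S)) l (A : atom (l ++ S)) c
      (r : sub (raised l (cl_vars c)) S),
    D c ->
    aconv A (asub (lifts l r) (raised_head l c)) ->
    der D Gam (l ▷ fsub (lifts l r) (raised_body l c)) ->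
    der D Gam (l ▷ fatom A).

Definition provable (D : definition) (B : form []) : Prop :=
  @der D [] [] ([] ▷ B).

(* Binders that give a name to the bound de Bruijn variable; what is under
   [n] of them and comes from outside is weakened [n] times by [⇑]. *)
Definition lam G a b (f : tm (a :: G) a -> tm (a :: G) b) : tm G (a ~> b) :=
  tlam (f (tvar vz)).
Definition all G t (f : tm (t :: G) t -> form (t :: G)) : form G := fall (f (tvar vz)).
Definition ex G t (f : tm (t :: G) t -> form (t :: G)) : form G := fex (f (tvar vz)).
Definition nab G t (f : tm (t :: G) t -> form (t :: G)) : form G := fnab (f (tvar vz)).

Notation Nil := (tcst c_nil).
Notation TauP P := (tcst c_tau ⋅ P).
Notation Plus P Q := (tcst c_plus ⋅ P ⋅ Q).
Notation Par P Q := (tcst c_par ⋅ P ⋅ Q).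
Notation Match x y P := (tcst c_match ⋅ x ⋅ y ⋅ P).
Notation Out x y P := (tcst c_out ⋅ x ⋅ y ⋅ P).
Notation Inp x M := (tcst c_in ⋅ x ⋅ M).
Notation Nu M := (tcst c_nu ⋅ M).
Notation Tau := (tcst c_atau).
Notation Dn x := (tcst c_dn ⋅ x).
Notation Up x := (tcst c_up ⋅ x).

Fixpoint nfun (xs G : ctx) (R : Type) : Type :=
  match xs with
  | [] => R
  | t :: xs' => tm G t -> nfun xs' G R
  end.

Fixpoint napp (xs G : ctx) (R : Type) : sub xs G -> nfun xs G R -> R :=
  match xs return sub xs G -> nfun xs G R -> R with
  | [] => fun _ f => f
  | t :: xs' => fun s f => napp R (fun _ x => s _ (vs x)) (f (s _ vz))
  end.
Arguments napp {xs G R} s f.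

(* [mk_clause [t1; ..; tn] (fun x1 .. xn => H ≜ B)] is forall x1 .. xn. H ≜ B. *)
Definition mk_clause (xs : ctx) (f : nfun xs xs (atom xs * form xs)) : clause :=
  let hb := napp (@idsub xs) f in Clause (fst hb) (snd hb).

Notation "H ≜ B" := (@pair (atom _) (form _) H B) (at level 90, no associativity) : fold_scope.

Definition D_pi : list clause :=
[ mk_clause [tp] (fun P => one (TauP P) Tau P ≜ ftop);
  mk_clause [tn; tn ~> tp] (fun X M => onep (Inp X M) (Dn X) M ≜ ftop);
  mk_clause [tn; tn; tp] (fun x y P => one (Out x y P) (Up x ⋅ y) P ≜ ftop);
  mk_clause [tn; tp; ta; tp] (fun x P A Q =>
    one (Match x x P) A Q ≜ one P A Q);
  mk_clause [tn; tp; tn ~> ta; tn ~> tp] (fun x P A M =>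
    onep (Match x x P) A M ≜ onep P A M);
  mk_clause [tp; tp; ta; tp] (fun P Q A R => one (Plus P Q) A R ≜ one P A R);
  mk_clause [tp; tp; ta; tp] (fun P Q A R => one (Plus P Q) A R ≜ one Q A R);
  mk_clause [tp; tp; tn ~> ta; tn ~> tp] (fun P Q A M =>
    onep (Plus P Q) A M ≜ onep P A M);
  mk_clause [tp; tp; tn ~> ta; tn ~> tp] (fun P Q A M =>
    onep (Plus P Q) A M ≜ onep Q A M);
  mk_clause [tp; tp; ta; tp] (fun P Q A P' =>
    one (Par P Q) A (Par P' Q) ≜ one P A P');
  mk_clause [tp; tp; ta; tp] (fun P Q A Q' =>
    one (Par P Q) A (Par P Q') ≜ one Q A Q');
  mk_clause [tp; tp; tn ~> ta; tn ~> tp] (fun P Q A M =>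
    onep (Par P Q) A (lam (fun n => Par (⇑M ⋅ n) ⇑Q)) ≜ onep P A M);
  mk_clause [tp; tp; tn ~> ta; tn ~> tp] (fun P Q A N =>
    onep (Par P Q) A (lam (fun n => Par ⇑P (⇑N ⋅ n))) ≜ onep Q A N);
  mk_clause [tn ~> tp; ta; tn ~> tp] (fun P A Q =>
    one (Nu (lam (fun n => ⇑P ⋅ n))) A (Nu (lam (fun n => ⇑Q ⋅ n)))
    ≜ nab (fun n : tm _ tn => one (⇑P ⋅ n) ⇑A (⇑Q ⋅ n)));
  mk_clause [tn ~> tp; tn ~> ta; tn ~> tn ~> tp] (fun P A P' =>
    onep (Nu (lam (fun n => ⇑P ⋅ n))) A
         (lam (fun m => Nu (lam (fun n => ⇑⇑P' ⋅ n ⋅ ⇑m))))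
    ≜ nab (fun n : tm _ tn => onep (⇑P ⋅ n) ⇑A (⇑P' ⋅ n)));
  mk_clause [tn ~> tp; tn; tn ~> tp] (fun M X M' =>
    onep (Nu (lam (fun n => ⇑M ⋅ n))) (Up X) M'
    ≜ nab (fun n : tm _ tn => one (⇑M ⋅ n) (Up ⇑X ⋅ n) (⇑M' ⋅ n)));
  mk_clause [tp; tp; tn ~> tp; tn ~> tp] (fun P Q M N =>
    one (Par P Q) Tau (Nu (lam (fun n => Par (⇑M ⋅ n) (⇑N ⋅ n))))
    ≜ ex (fun X : tm _ tn => onep ⇑P (Dn X) ⇑M ⊓ onep ⇑Q (Up X) ⇑N));
  mk_clause [tp; tp; tn ~> tp; tn ~> tp] (fun P Q M N =>
    one (Par P Q) Tau (Nu (lam (fun n => Par (⇑M ⋅ n) (⇑N ⋅ n))))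
    ≜ ex (fun X : tm _ tn => onep ⇑P (Up X) ⇑M ⊓ onep ⇑Q (Dn X) ⇑N));
  mk_clause [tp; tp; tn ~> tp; tn; tp] (fun P Q M Y Q' =>
    one (Par P Q) Tau (Par (M ⋅ Y) Q')
    ≜ ex (fun X : tm _ tn => onep ⇑P (Dn X) ⇑M ⊓ one ⇑Q (Up X ⋅ ⇑Y) ⇑Q'));
  mk_clause [tp; tp; tp; tn ~> tp; tn] (fun P Q P' N Y =>
    one (Par P Q) Tau (Par P' (N ⋅ Y))
    ≜ ex (fun X : tm _ tn => one ⇑P (Up X ⋅ ⇑Y) ⇑P' ⊓ onep ⇑Q (Dn X) ⇑N)) ].

Definition lbisim_clause : clause :=
  mk_clause [tp; tp] (fun P Q => lbisim P Q ≜
       all (fun A : tm _ ta => all (fun P' : tm _ tp =>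
         one ⇑⇑P ⇑A P' ⊃ ex (fun Q' : tm _ tp =>
           one ⇑⇑⇑Q ⇑⇑A Q' ⊓ lbisim ⇑P' Q')))
     ⊓ all (fun X : tm _ tn => all (fun P' : tm _ (tn ~> tp) =>
         onep ⇑⇑P (Dn ⇑X) P' ⊃ ex (fun Q' : tm _ (tn ~> tp) =>
           onep ⇑⇑⇑Q (Dn ⇑⇑X) Q' ⊓
           all (fun w : tm _ tn => lbisim (⇑⇑P' ⋅ w) (⇑Q' ⋅ w)))))
     ⊓ all (fun X : tm _ tn => all (fun P' : tm _ (tn ~> tp) =>
         onep ⇑⇑P (Up ⇑X) P' ⊃ ex (fun Q' : tm _ (tn ~> tp) =>
           onep ⇑⇑⇑Q (Up ⇑⇑X) Q' ⊓
           nab (fun w : tm _ tn => lbisim (⇑⇑P' ⋅ w) (⇑Q' ⋅ w)))))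
     ⊓ all (fun A : tm _ ta => all (fun Q' : tm _ tp =>
         one ⇑⇑Q ⇑A Q' ⊃ ex (fun P' : tm _ tp =>
           one ⇑⇑⇑P ⇑⇑A P' ⊓ lbisim ⇑Q' P')))
     ⊓ all (fun X : tm _ tn => all (fun Q' : tm _ (tn ~> tp) =>
         onep ⇑⇑Q (Dn ⇑X) Q' ⊃ ex (fun P' : tm _ (tn ~> tp) =>
           onep ⇑⇑⇑P (Dn ⇑⇑X) P' ⊓
           all (fun w : tm _ tn => lbisim (⇑⇑Q' ⋅ w) (⇑P' ⋅ w)))))
     ⊓ all (fun X : tm _ tn => all (fun Q' : tm _ (tn ~> tp) =>
         onep ⇑⇑Q (Up ⇑X) Q' ⊃ ex (fun P' : tm _ (tn ~> tp) =>
           onep ⇑⇑⇑P (Up ⇑⇑X) P' ⊓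
           nab (fun w : tm _ tn => lbisim (⇑⇑Q' ⋅ w) (⇑P' ⋅ w)))))).

Definition ebisim_clause : clause :=
  mk_clause [tp; tp] (fun P Q => ebisim P Q ≜
       all (fun A : tm _ ta => all (fun P' : tm _ tp =>
         one ⇑⇑P ⇑A P' ⊃ ex (fun Q' : tm _ tp =>
           one ⇑⇑⇑Q ⇑⇑A Q' ⊓ ebisim ⇑P' Q')))
     ⊓ all (fun X : tm _ tn => all (fun P' : tm _ (tn ~> tp) =>
         onep ⇑⇑P (Dn ⇑X) P' ⊃ all (fun w : tm _ tn => ex (fun Q' : tm _ (tn ~> tp) =>
           onep ⇑⇑⇑⇑Q (Dn ⇑⇑⇑X) Q' ⊓ ebisim (⇑⇑P' ⋅ ⇑w) (Q' ⋅ ⇑w)))))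
     ⊓ all (fun X : tm _ tn => all (fun P' : tm _ (tn ~> tp) =>
         onep ⇑⇑P (Up ⇑X) P' ⊃ ex (fun Q' : tm _ (tn ~> tp) =>
           onep ⇑⇑⇑Q (Up ⇑⇑X) Q' ⊓
           nab (fun w : tm _ tn => ebisim (⇑⇑P' ⋅ w) (⇑Q' ⋅ w)))))
     ⊓ all (fun A : tm _ ta => all (fun Q' : tm _ tp =>
         one ⇑⇑Q ⇑A Q' ⊃ ex (fun P' : tm _ tp =>
           one ⇑⇑⇑P ⇑⇑A P' ⊓ ebisim ⇑Q' P')))
     ⊓ all (fun X : tm _ tn => all (fun Q' : tm _ (tn ~> tp) =>
         onep ⇑⇑Q (Dn ⇑X) Q' ⊃ all (fun w : tm _ tn => ex (fun P' : tm _ (tn ~> tp) =>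
           onep ⇑⇑⇑⇑P (Dn ⇑⇑⇑X) P' ⊓ ebisim (⇑⇑Q' ⋅ ⇑w) (P' ⋅ ⇑w)))))
     ⊓ all (fun X : tm _ tn => all (fun Q' : tm _ (tn ~> tp) =>
         onep ⇑⇑Q (Up ⇑X) Q' ⊃ ex (fun P' : tm _ (tn ~> tp) =>
           onep ⇑⇑⇑P (Up ⇑⇑X) P' ⊓
           nab (fun w : tm _ tn => ebisim (⇑⇑Q' ⋅ w) (⇑P' ⋅ w)))))).

Definition equal_clause (t : ty) : clause :=
  mk_clause [t] (fun x => equal x x ≜ ftop).

(* Equality belongs to the logic, whence its clause at each type. *)
Definition D_bisim : definition :=
  fun c => In c D_pi \/ c = lbisim_clause \/ c = ebisim_clause \/
           exists t, c = equal_clause t.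

(* Processes, up to renaming of bound names, whose free names are among the k
   names [Fin.t k]; under a binder the bound name is [Fin.F1]. *)
Inductive proc (k : nat) : Type :=
| pi_nil : proc k
| pi_tau : proc k -> proc k
| pi_plus : proc k -> proc k -> proc k
| pi_par : proc k -> proc k -> proc k
| pi_match : Fin.t k -> Fin.t k -> proc k -> proc k
| pi_out : Fin.t k -> Fin.t k -> proc k -> proc k
| pi_in : Fin.t k -> proc (S k) -> proc k
| pi_nu : proc (S k) -> proc k.

Fixpoint free k (x : Fin.t k) (P : proc k) : Prop :=
  match P with
  | pi_nil _ => False
  | pi_tau P => free x P
  | pi_plus P Q | pi_par P Q => free x P \/ free x Q
  | pi_match y z P | pi_out y z P => x = y \/ x = z \/ free x P
  | pi_in y P => x = y \/ free (Fin.FS x) P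
  | pi_nu P => free (Fin.FS x) P
  end.

Definition names (k : nat) : ctx := repeat tn k.

Fixpoint name_var k (x : Fin.t k) : var (names k) tn :=
  match x in Fin.t k return var (names k) tn with
  | Fin.F1 => vz
  | Fin.FS y => vs (name_var y)
  end.

Definition name k (x : Fin.t k) : tm (names k) tn := tvar (name_var x).

Fixpoint enc k (P : proc k) : tm (names k) tp :=
  match P with
  | pi_nil _ => Nil
  | pi_tau P => TauP (enc P)
  | pi_plus P Q => Plus (enc P) (enc Q)
  | pi_par P Q => Par (enc P) (enc Q)
  | pi_match x y P => Match (name x) (name y) (enc P)
  | pi_out x y P => Out (name x) (name y) (enc P)
  | pi_in x P => Inp (name x) (tlam (enc P : tm (tn :: names k) tp))
  | pi_nu P => Nu (tlam (enc P : tm (tn :: names k) tp))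
  end.

Fixpoint close (k : nat) : form (names k) -> form [] :=
  match k return form (names k) -> form [] with
  | 0 => fun B => B
  | S k' => fun B => close k' (fall (B : form (tn :: names k')))
  end.

(* Main.v *)
Require Import Defs.
From Stdlib Require Import FunctionalExtensionality Program.Equality Lia.
Set Implicit Arguments.

(** A syntactic proof would have to invert arbitrary derivations, with cuts and with arbitrary
    complete sets of unifiers; soundness deals with all of them in one induction on the derivation.
    The model must have many worlds because names are variables: a test of equality that fails now
    may succeed under a later substitution, so implications and universal quantifiers have to be
    read in all later worlds. This is also why late and early agree: nothing in the logic decides
    whether two names are equal, so an answer cannot be chosen by cases on the received name.

    The delicate point is the independence of the answer from the generic name. Terms are given only
    up to conversion, for which occurrence of a variable is not a stable notion; it is replaced by
    invariance, up to conversion, under a substitution that eliminates the variable. Passing from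
    the invariance of a process to that of its components requires the constants to be injective up
    to beta-eta, and this is what the logical relation is for. *)

(** Soundness in a Kripke model reduces provability to semantics.  The worlds are
    the global signatures, the morphisms are the substitutions, one and onep are
    interpreted by the least relations closed under the clauses of D_pi, and the
    bisimilarities by fixed points of their clauses.  The model is closed under
    cut, and an existential is forced only through a witness.  Conversely, a
    forced bisimilarity of processes of bounded size is derivable: defL applied
    with the set of all unifiers replaces a transition in the antecedent by its
    semantic solutions, and terminates because transitions decrease sizes.

    In the model, early bisimilarity implies late bisimilarity because the input
    clause can be instantiated at a generic name: the continuation of the answer
    is determined by the answering process, so it does not depend on that name
    and serves for all names. *)

(** * Substitution *)

(** Case analysis on a variable of a nonempty context, where [destruct] is blocked by the index
    [a :: G]. The match returns a function of [P] and its hypotheses, so that the types are refined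
    together with the context. *)
Definition var_case a G (P : forall t, var (a :: G) t -> Prop)
    (Hz : P a vz) (Hs : forall t (x : var G t), P t (vs x)) t (x : var (a :: G) t) : P t x :=
  match x as x' in var H u
    return match H return var H u -> Prop with
           | [] => fun _ => True
           | b :: H' => fun x' => forall P : forall t, var (b :: H') t -> Prop,
               P b vz -> (forall t (x : var H' t), P t (vs x)) -> P u x'
           end x' with
  | vz => fun P Hz _ => Hz
  | vs y => fun P _ Hs => Hs _ y
  end P Hz Hs.

Lemma sub_ext G D (s r : sub G D) : (forall t x, s t x = r t x) -> s = r.
Proof.
  intros H. apply functional_extensionality_dep. intros t.
  apply functional_extensionality. auto.
Qed.

Lemma sub_ext_cons a G D (s r : sub (a :: G) D) :
  s _ vz = r _ vz -> (forall t x, s t (vs x) = r t (vs x)) -> s = r.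
Proof. intros Hz Hs. apply sub_ext. apply (var_case (fun t x => s t x = r t x)); auto. Qed.

Lemma ren_ext_cons a G D (s r : ren (a :: G) D) :
  s _ vz = r _ vz -> (forall t x, s t (vs x) = r t (vs x)) -> s = r.
Proof.
  intros Hz Hs. apply functional_extensionality_dep. intros t.
  apply functional_extensionality. apply (var_case (fun t x => s t x = r t x)); auto.
Qed.

(** The composition laws come in a fixed order because [up] is built from a renaming: to go under a
    binder, [tren_tsub] needs [tren_tren], and [tsub_tsub] needs both mixed laws. *)
Lemma tren_tren G t (M : tm G t) : forall D E (r : ren G D) (q : ren D E),
  tren q (tren r M) = tren (fun _ x => q _ (r _ x)) M.
Proof.
  induction M; intros; cbn; f_equal; auto.
  rewrite IHM. f_equal. apply ren_ext_cons; auto.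
Qed.

Lemma tsub_tren G t (M : tm G t) : forall D E (r : ren G D) (s : sub D E),
  tsub s (tren r M) = tsub (fun _ x => s _ (r _ x)) M.
Proof.
  induction M; intros; cbn; f_equal; auto.
  rewrite IHM. f_equal. apply sub_ext_cons; auto.
Qed.

Lemma tren_tsub G t (M : tm G t) : forall D E (s : sub G D) (r : ren D E),
  tren r (tsub s M) = tsub (fun _ x => tren r (s _ x)) M.
Proof.
  induction M; intros; cbn; f_equal; auto.
  rewrite IHM. f_equal. apply sub_ext_cons; auto.
  intros u x. cbn. unfold wk. rewrite !tren_tren. reflexivity.
Qed.

Lemma tsub_wk G D a t (N : tm D a) (s : sub G D) (M : tm G t) :
  tsub (scons N s) ⇑M = tsub s M.
Proof. unfold wk. rewrite tsub_tren. reflexivity. Qed.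

Lemma tsub_up_wk G D a t (s : sub G D) (M : tm G t) :
  tsub (up s) (⇑M : tm (a :: G) t) = ⇑(tsub s M).
Proof. unfold wk. rewrite tsub_tren, tren_tsub. reflexivity. Qed.

Lemma up_scomp G D E a (s : sub G D) (r : sub D E) :
  scomp (@up G D a s) (up r) = up (scomp s r).
Proof.
  apply sub_ext_cons; auto. intros t x. unfold scomp. cbn. apply tsub_up_wk.
Qed.

Lemma tsub_tsub G t (M : tm G t) : forall D E (s : sub G D) (r : sub D E),
  tsub r (tsub s M) = tsub (scomp s r) M.
Proof.
  induction M; intros; cbn; f_equal; auto.
  rewrite IHM. f_equal. apply up_scomp.
Qed.

Lemma up_id G a : up (@idsub G) = @idsub (a :: G).
Proof. apply sub_ext_cons; auto. Qed.

Lemma tsub_id G t (M : tm G t) : tsub (@idsub G) M = M.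
Proof. induction M; cbn; f_equal; auto. rewrite up_id. auto. Qed.

Lemma tren_sub G D t (r : ren G D) (M : tm G t) :
  tren r M = tsub (fun _ x => tvar (r _ x)) M.
Proof. rewrite <- (tsub_id M) at 1. apply tren_tsub. Qed.

Lemma wk_sub G a t (M : tm G t) : ⇑M = tsub (@wksub G a) M.
Proof. apply tren_sub. Qed.

Lemma scomp_assoc G D E F (s : sub G D) (r : sub D E) (q : sub E F) :
  scomp (scomp s r) q = scomp s (scomp r q).
Proof. apply sub_ext. intros. apply tsub_tsub. Qed.

Lemma scomp_idl G D (s : sub G D) : scomp (@idsub G) s = s.
Proof. reflexivity. Qed.

Lemma scomp_idr G D (s : sub G D) : scomp s (@idsub D) = s.
Proof. apply sub_ext. intros. apply tsub_id. Qed.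

Lemma scomp_scons G D E a (N : tm D a) (s : sub G D) (r : sub D E) :
  scomp (scons N s) r = scons (tsub r N) (scomp s r).
Proof. apply sub_ext_cons; auto. Qed.

Lemma up_scons G D E a (s : sub G D) (N : tm E a) (r : sub D E) :
  scomp (up s) (scons N r) = scons N (scomp s r).
Proof.
  apply sub_ext_cons; auto. intros t x. unfold scomp. cbn. apply tsub_wk.
Qed.

Lemma wk_scons G D a (N : tm D a) (s : sub G D) : scomp (@wksub G a) (scons N s) = s.
Proof. apply sub_ext. reflexivity. Qed.

Lemma lifts_scomp l G D E (s : sub G D) (r : sub D E) :
  scomp (lifts l s) (lifts l r) = lifts l (scomp s r).
Proof. induction l; cbn; auto. rewrite <- IHl. apply up_scomp. Qed.

Lemma lifts_id l G : lifts l (@idsub G) = @idsub (l ++ G).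
Proof. induction l; cbn; auto. rewrite IHl. apply up_id. Qed.

Lemma tsub_lifts l G D E t (M : tm (l ++ G) t) (s : sub G D) (r : sub D E) :
  tsub (lifts l r) (tsub (lifts l s) M) = tsub (lifts l (scomp s r)) M.
Proof. rewrite tsub_tsub, lifts_scomp. reflexivity. Qed.

Lemma asub_asub G D E (A : atom G) (s : sub G D) (r : sub D E) :
  asub r (asub s A) = asub (scomp s r) A.
Proof. destruct A; cbn; rewrite !tsub_tsub; reflexivity. Qed.

Lemma asub_id G (A : atom G) : asub (@idsub G) A = A.
Proof. destruct A; cbn; rewrite !tsub_id; reflexivity. Qed.

Lemma fsub_fsub G (B : form G) : forall D E (s : sub G D) (r : sub D E),
  fsub r (fsub s B) = fsub (scomp s r) B.
Proof.
  induction B; intros; cbn; f_equal; auto; try apply asub_asub;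
    rewrite IHB; f_equal; apply up_scomp.
Qed.

Lemma fsub_id G (B : form G) : fsub (@idsub G) B = B.
Proof. induction B; cbn; f_equal; auto; try apply asub_id; rewrite up_id; auto. Qed.

Lemma jsub_jsub S S' S'' (s : sub S S') (r : sub S' S'') (J : jdg S) :
  jsub r (jsub s J) = jsub (scomp s r) J.
Proof. unfold jsub. cbn. rewrite fsub_fsub, lifts_scomp. reflexivity. Qed.

Lemma jsub_id S (J : jdg S) : jsub (@idsub S) J = J.
Proof. destruct J. unfold jsub. cbn. rewrite lifts_id, fsub_id. reflexivity. Qed.

Lemma map_jsub_jsub S S' S'' (s : sub S S') (r : sub S' S'') Gam :
  map (jsub r) (map (jsub s) Gam) = map (jsub (scomp s r)) Gam.
Proof. rewrite map_map. apply map_ext. intros. apply jsub_jsub. Qed.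

Lemma map_jsub_id S (Gam : list (jdg S)) : map (jsub (@idsub S)) Gam = Gam.
Proof. rewrite <- map_id. apply map_ext. apply jsub_id. Qed.

Lemma conv_eq G t (M N : tm G t) : M = N -> conv M N.
Proof. intros []. apply conv_refl. Qed.

Lemma conv_tsub G t (M N : tm G t) : conv M N ->
  forall D (s : sub G D), conv (tsub s M) (tsub s N).
Proof.
  induction 1; intros; cbn.
  - apply conv_refl.
  - apply conv_sym; auto.
  - eapply conv_trans; eauto.
  - apply conv_app; auto.
  - apply conv_lam; auto.
  - eapply conv_trans; [apply conv_beta |]. apply conv_eq.
    rewrite !tsub_tsub, up_scons, scomp_scons, scomp_idl, scomp_idr. reflexivity.
  - eapply conv_trans; [apply conv_eta |]. rewrite tsub_up_wk. apply conv_refl.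
Qed.

Lemma conv_wk G a t (M N : tm G t) : conv M N -> conv (⇑M : tm (a :: G) t) ⇑N.
Proof. rewrite !wk_sub. intros H. apply conv_tsub, H. Qed.

Lemma sconv_cons a G D (s r : sub (a :: G) D) :
  conv (s _ vz) (r _ vz) -> (forall t x, conv (s t (vs x)) (r t (vs x))) -> sconv s r.
Proof. intros Hz Hs. intro. apply (var_case (fun t x => conv (s t x) (r t x))); auto. Qed.

Lemma sconv_refl G D (s : sub G D) : sconv s s.
Proof. intros t x. apply conv_refl. Qed.

Lemma sconv_sym G D (s r : sub G D) : sconv s r -> sconv r s.
Proof. intros H t x. apply conv_sym, H. Qed.

Lemma sconv_scons a G D (M N : tm D a) (s r : sub G D) :
  conv M N -> sconv s r -> sconv (scons M s) (scons N r).
Proof. intros. apply sconv_cons; auto. Qed.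

Lemma sconv_up a G D (s r : sub G D) : sconv s r -> sconv (@up G D a s) (up r).
Proof. intros. apply sconv_cons; [apply conv_refl | intros; apply conv_wk, H]. Qed.

Lemma tsub_sconv G t (M : tm G t) : forall D (s r : sub G D),
  sconv s r -> conv (tsub s M) (tsub r M).
Proof.
  induction M; intros; cbn; auto using conv_refl, conv_app, conv_lam, sconv_up.
Qed.

Lemma sconv_scomp_l G D E (s r : sub G D) (q : sub D E) :
  sconv s r -> sconv (scomp s q) (scomp r q).
Proof. intros H t x. apply conv_tsub, H. Qed.

Lemma sconv_scomp_r G D E (s : sub G D) (q q' : sub D E) :
  sconv q q' -> sconv (scomp s q) (scomp s q').
Proof. intros H t x. apply tsub_sconv, H. Qed.

Lemma sconv_lifts l G D (s r : sub G D) : sconv s r -> sconv (lifts l s) (lifts l r).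
Proof. intros. induction l; cbn; auto using sconv_up. Qed.

Lemma aconv_refl G (A : atom G) : aconv A A.
Proof. destruct A; constructor; apply conv_refl. Qed.

Lemma aconv_sym G (A B : atom G) : aconv A B -> aconv B A.
Proof. destruct 1; constructor; apply conv_sym; auto. Qed.

(** Inversion of [aconv] in the form of a function. The type hidden in [equal] would make ordinary
    inversion produce equalities of dependent pairs; here the type of the left-hand atom is imposed
    on the right-hand one. *)
Definition aconv_with G (A B : atom G) : Prop :=
  match A with
  | one P A Q => match B with one P' A' Q' => conv P P' /\ conv A A' /\ conv Q Q' | _ => False end
  | onep P A Q => match B with onep P' A' Q' => conv P P' /\ conv A A' /\
  conv Q Q' | _ => False end
  | lbisim P Q => match B with lbisim P' Q' => conv P P' /\ conv Q Q' | _ => False end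
  | ebisim P Q => match B with ebisim P' Q' => conv P P' /\ conv Q Q' | _ => False end
  | @equal _ t M N => exists M' N' : tm G t, B = equal M' N' /\ conv M M' /\ conv N N'
  end.

Lemma aconv_inv G (A B : atom G) : aconv A B -> aconv_with A B.
Proof. destruct 1; cbn; eauto. Qed.

Lemma aconv_trans G (A B C : atom G) : aconv A B -> aconv B C -> aconv A C.
Proof.
  intros H1 H2. apply aconv_inv in H2. destruct H1; cbn in H2.
  1-4: destruct C; try contradiction; decompose [and] H2; constructor; eapply conv_trans; eauto.
  destruct H2 as (M0 & N0 & -> & ? & ?). constructor; eapply conv_trans; eauto.
Qed.

Lemma aconv_asub G D (s : sub G D) (A B : atom G) : aconv A B -> aconv (asub s A) (asub s B).
Proof. destruct 1; constructor; apply conv_tsub; auto. Qed.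

Lemma asub_sconv G D (s r : sub G D) (A : atom G) : sconv s r -> aconv (asub s A) (asub r A).
Proof. intros. destruct A; constructor; apply tsub_sconv; auto. Qed.

Lemma fconv_fsub_sconv G (B : form G) : forall D (s r : sub G D), sconv s r ->
  fconv (fsub s B) (fsub r B).
Proof.
  induction B; intros; cbn; constructor; auto using sconv_up, asub_sconv.
Qed.

(** * Raising over a local signature *)

Fixpoint raise_lam l G t : tm (l ++ G) t -> tm G (raise l t) :=
  match l return forall t, tm (l ++ G) t -> tm G (raise l t) with
  | [] => fun _ N => N
  | a :: l' => fun t N => raise_lam l' G (tlam N : tm (l' ++ G) (a ~> t))
  end t.
Arguments raise_lam l {G t} N.

Definition raise_app l G t (H : tm G (raise l t)) : tm (l ++ G) t :=
  spine (fun _ x => tvar (inl_var G x)) (tren (fun _ x => inr_var l x) H).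
Arguments raise_app l {G t} H.

Lemma spine_sub l : forall G D t (s : sub G D) (q : sub l G) (h : tm G (raise l t)),
  tsub s (spine q h) = spine (scomp q s) (tsub s h).
Proof. induction l; intros; cbn; auto. rewrite IHl. reflexivity. Qed.

Lemma lifts_inl l G D (s : sub G D) t (x : var l t) :
  lifts l s (inl_var G x) = tvar (inl_var D x).
Proof. induction x; cbn; auto. rewrite IHx. reflexivity. Qed.

Lemma lifts_inr l G D (s : sub G D) t (x : var G t) :
  lifts l s (inr_var l x) = tren (fun _ x => inr_var l x) (s _ x).
Proof.
  induction l; cbn.
  - rewrite tren_sub. symmetry. apply tsub_id.
  - rewrite IHl. unfold wk. rewrite tren_tren. reflexivity.
Qed.

Lemma tsub_app_loc l G D t (s : sub G D) (h : var G (raise l t)) :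
  tsub (lifts l s) (app_loc l h) = raise_app l (s _ h).
Proof.
  unfold app_loc, raise_app. rewrite spine_sub. cbn. rewrite lifts_inr. f_equal.
  apply sub_ext. intros. apply lifts_inl.
Qed.

Lemma raise_app_cons a l G t (H : tm G (raise (a :: l) t)) :
  raise_app (a :: l) H = ⇑(raise_app l (t := a ~> t) H) ⋅ tvar vz.
Proof.
  unfold raise_app at 2. rewrite wk_sub, spine_sub, <- wk_sub. unfold wk. rewrite tren_tren.
  reflexivity.
Qed.

(** Abstracting the local variables and applying the result to them again is a sequence of
    beta-redexes. Raising therefore loses no generality: an eigenvariable applied to the local
    variables can be instantiated to any term over the local signature. *)
Lemma raise_app_raise_lam l : forall G t (N :
  tm (l ++ G) t), conv (raise_app l (raise_lam l N)) N.
Proof.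
  induction l; intros.
  - unfold raise_app. cbn. rewrite tren_sub. apply conv_eq, tsub_id.
  - rewrite raise_app_cons. cbn [raise_lam].
    eapply conv_trans; [apply conv_app; [apply conv_wk, IHl | apply conv_refl] |].
    eapply conv_trans; [apply conv_beta |]. apply conv_eq.
    rewrite tren_sub, tsub_tsub. rewrite <- (tsub_id N) at 2. f_equal.
    apply sub_ext_cons; auto.
Qed.

(** * The Kripke model *)

Fixpoint horn G (B : form G) : bool :=
  match B with
  | fatom (one _ _ _) | fatom (onep _ _ _) | ftop => true
  | fand B C => andb (horn B) (horn C)
  | fex B | fnab B => horn B
  | _ => false
  end.

(* Bodies of the clauses of D_pi contain neither implication nor universal
   quantification, so their truth does not depend on which variables are local;
   the two signatures are merged into [D]. *)
Inductive holds : forall G, form G -> forall D, sub G D -> Prop :=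
| holds_top : forall G D (s : sub G D), holds ftop s
| holds_and : forall G B C D (s : sub G D), holds B s -> holds C s -> holds (fand B C) s
| holds_ex : forall G t (B : form (t :: G)) D (N : tm D t) (s : sub G D),
    holds B (scons N s) -> holds (fex B) s
| holds_nab : forall G t (B : form (t :: G)) D (s : sub G D), holds B (up s) -> holds (fnab B) s
| holds_atom : forall G (A : atom G) D (s : sub G D) c (r : sub (cl_vars c) D),
    In c D_pi -> aconv (asub s A) (asub r (cl_head c)) -> holds (cl_body c) r ->
    holds (fatom A) s.

Definition holds_with G (B : form G) D (s : sub G D) : Prop :=
  match B in form _ return Prop with
  | fatom A => exists c (r : sub (cl_vars c) D),
      In c D_pi /\ aconv (asub s A) (asub r (cl_head c)) /\ holds (cl_body c) r
  | ftop => True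
  | fand B C => holds B s /\ holds C s
  | @fex _ t B => exists N : tm D t, holds B (scons N s)
  | fnab B => holds B (up s)
  | _ => False
  end.

Lemma holds_inv G (B : form G) D (s : sub G D) : holds B s -> holds_with B s.
Proof. destruct 1; cbn; eauto. exists c, r. auto. Qed.

Lemma holds_atom_conv G D E (A : atom G) (A' : atom D) (s : sub G E) (s' : sub D E) :
  aconv (asub s' A') (asub s A) -> holds (fatom A) s -> holds (fatom A') s'.
Proof.
  intros H Hf. apply holds_inv in Hf. destruct Hf as (c & r & ? & ? & ?).
  eapply holds_atom; eauto. eapply aconv_trans; eauto.
Qed.

Lemma holds_sconv G (B : form G) D (s r : sub G D) : sconv s r -> holds B s -> holds B r.
Proof.
  intros H Hf. revert r H. induction Hf; intros.
  - apply holds_top.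
  - apply holds_and; auto.
  - eapply holds_ex. apply IHHf. apply sconv_scons; [apply conv_refl | auto].
  - apply holds_nab. apply IHHf. apply sconv_up; auto.
  - eapply holds_atom; eauto. eapply aconv_trans; [| eassumption].
    apply asub_sconv. apply sconv_sym. auto.
Qed.

(** Clauses test names only for being equal, never for being distinct, so a transition survives
    every substitution, including one that identifies names. *)
Lemma holds_sub G (B : form G) D (s : sub G D) : holds B s ->
  forall E (r : sub D E), holds B (scomp s r).
Proof.
  induction 1; intros.
  - apply holds_top.
  - apply holds_and; auto.
  - eapply holds_ex. rewrite <- scomp_scons. auto.
  - apply holds_nab. rewrite <- up_scomp. auto.
  - apply holds_atom with (c := c) (r := scomp r r0); auto.
    rewrite <- (asub_asub A s), <- (asub_asub (cl_head c) r). apply aconv_asub. assumption.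
Qed.

Definition step_one G (P : tm G tp) A Q := holds (fatom (one P A Q)) (@idsub G).
Definition step_onep G (P : tm G tp) A M := holds (fatom (onep P A M)) (@idsub G).

Lemma holds_one G D (s : sub G D) P A Q :
  holds (fatom (one P A Q)) s <-> step_one (tsub s P) (tsub s A) (tsub s Q).
Proof.
  split; apply holds_atom_conv; rewrite ?asub_id; apply aconv_refl.
Qed.

Lemma holds_onep G D (s : sub G D) P A Q :
  holds (fatom (onep P A Q)) s <-> step_onep (tsub s P) (tsub s A) (tsub s Q).
Proof.
  split; apply holds_atom_conv; rewrite ?asub_id; apply aconv_refl.
Qed.

Lemma step_one_conv G (P P' : tm G tp) A A' Q Q' :
  conv P P' -> conv A A' -> conv Q Q' -> step_one P A Q -> step_one P' A' Q'.
Proof.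
  intros. eapply holds_atom_conv; [| eassumption]. rewrite !asub_id.
  constructor; apply conv_sym; auto.
Qed.

Lemma step_onep_conv G (P P' : tm G tp) A A' Q Q' :
  conv P P' -> conv A A' -> conv Q Q' -> step_onep P A Q -> step_onep P' A' Q'.
Proof.
  intros. eapply holds_atom_conv; [| eassumption]. rewrite !asub_id.
  constructor; apply conv_sym; auto.
Qed.

Lemma step_onep_sub G D (s : sub G D) P A Q :
  step_onep P A Q -> step_onep (tsub s P) (tsub s A) (tsub s Q).
Proof. intros H. apply (proj1 (holds_onep s P A Q)), (holds_sub H s). Qed.

Definition bisrel := forall S l, tm (l ++ S) tp -> tm (l ++ S) tp -> Prop.

(* [late] selects between lbisim and ebisim.  The guards [late = true] and
   [late = false] replace an [if], which the positivity checker would reject in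
   [bisim]. *)
Definition simulates (late : bool) (R : bisrel) S l (P Q : tm (l ++ S) tp) : Prop :=
  (forall S' (s : sub S S') A P', step_one (tsub (lifts l s) P) A P' ->
    exists Q', step_one (tsub (lifts l s) Q) A Q' /\ R S' l P' Q') /\
  (late = true -> forall S' (s : sub S S') X M, step_onep (tsub (lifts l s) P) (Dn X) M ->
    exists N, step_onep (tsub (lifts l s) Q) (Dn X) N /\
      forall S'' (s' :
      sub S' S'') w, R S'' l (tsub (lifts l s') M ⋅ w) (tsub (lifts l s') N ⋅ w)) /\
  (late = false -> forall S' (s : sub S S') X M, step_onep (tsub (lifts l s) P) (Dn X) M ->
    forall S'' (s' : sub S' S'') w,
    exists N, step_onep (tsub (lifts l (scomp s s')) Q) (Dn (tsub (lifts l s') X)) N /\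
      R S'' l (tsub (lifts l s') M ⋅ w) (N ⋅ w)) /\
  (forall S' (s : sub S S') X M, step_onep (tsub (lifts l s) P) (Up X) M ->
    exists N, step_onep (tsub (lifts l s) Q) (Up X) N /\
      R S' (tn :: l) (⇑M ⋅ tvar vz) (⇑N ⋅ tvar vz)).

(** The inductive definition only serves to supply a fixed point: it is folded and unfolded, and
    inductions run on sizes instead. *)
Inductive bisim (late : bool) S l (P Q : tm (l ++ S) tp) : Prop :=
| bisim_intro : simulates late (@bisim late) S l P Q -> simulates late (@bisim late) S l Q P ->
    bisim late S l P Q.

(** One unfolding is enough: transitions are closed under conversion, so the converted processes
    have the same derivatives and the recursive occurrences of bisimilarity do not change. *)
Lemma bisim_conv late S l (P P' Q Q' : tm (l ++ S) tp) :
  conv P P' -> conv Q Q' -> bisim late S l P Q -> bisim late S l P' Q'.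
Proof.
  intros HP HQ [H1 H2].
  assert (half : forall (P P' Q Q' : tm (l ++ S) tp), conv P P' -> conv Q Q' ->
    simulates late (@bisim late) S l P Q -> simulates late (@bisim late) S l P' Q').
  { clear. intros P P' Q Q' HP HQ (H1 & H2 & H3 & H4).
    assert (HP' : forall S' (s : sub S S'), conv (tsub (lifts l s) P') (tsub (lifts l s) P))
      by (intros; apply conv_tsub, conv_sym, HP).
    assert (HQ' : forall S' (s : sub S S'), conv (tsub (lifts l s) Q) (tsub (lifts l s) Q'))
      by (intros; apply conv_tsub, HQ).
    split; [| split; [| split]].
    - intros S' s A R HR. destruct (H1 S' s A R) as (R' & HR' & HB).
      + eapply step_one_conv; [apply HP' | apply conv_refl | apply conv_refl | exact HR].
      + exists R'. split; auto.
        eapply step_one_conv; [apply HQ' | apply conv_refl | apply conv_refl | exact HR'].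
    - intros E S' s X M HR. destruct (H2 E S' s X M) as (R' & HR' & HB).
      + eapply step_onep_conv; [apply HP' | apply conv_refl | apply conv_refl | exact HR].
      + exists R'. split; auto.
        eapply step_onep_conv; [apply HQ' | apply conv_refl | apply conv_refl | exact HR'].
    - intros E S' s X M HR S'' s' w. edestruct (H3 E S' s X M) as (R' & HR' & HB).
      + eapply step_onep_conv; [apply HP' | apply conv_refl | apply conv_refl | exact HR].
      + exists R'. split; [| eassumption].
        eapply step_onep_conv; [apply HQ' | apply conv_refl | apply conv_refl | exact HR'].
    - intros S' s X M HR. destruct (H4 S' s X M) as (R' & HR' & HB).
      + eapply step_onep_conv; [apply HP' | apply conv_refl | apply conv_refl | exact HR].
      + exists R'. split; auto.
        eapply step_onep_conv; [apply HQ' | apply conv_refl | apply conv_refl | exact HR']. }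
  constructor; eapply half; eauto.
Qed.

(** Again one unfolding: [simulates] already ranges over all later worlds, and substitutions
    compose. *)
Lemma bisim_sub late S l (P Q : tm (l ++ S) tp) S' (s : sub S S') :
  bisim late S l P Q -> bisim late S' l (tsub (lifts l s) P) (tsub (lifts l s) Q).
Proof.
  intros [H1 H2].
  assert (half : forall (P Q : tm (l ++ S) tp),
    simulates late (@bisim late) S l P Q ->
    simulates late (@bisim late) S' l (tsub (lifts l s) P) (tsub (lifts l s) Q)).
  { clear. intros P Q (H1 & H2 & H3 & H4).
    split; [| split; [| split]]; intros; rewrite !tsub_lifts in *; eauto.
    rewrite <- scomp_assoc. eauto. }
  constructor; auto.
Qed.

(* [S] is the world and [l] the local signature; the formula is evaluated under
   the substitution [s] rather than substituted, so that the recursion is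
   structural. *)
Fixpoint force G (B : form G) S l (s : sub G (l ++ S)) {struct B} : Prop :=
  match B with
  | fatom A =>
      match A with
      | one _ _ _ | onep _ _ _ => holds (fatom A) s
      | lbisim P Q => bisim true S l (tsub s P) (tsub s Q)
      | ebisim P Q => bisim false S l (tsub s P) (tsub s Q)
      | equal M N => conv (tsub s M) (tsub s N)
      end
  | ftop => True
  | fbot => False
  | fand B C => force B S l s /\ force C S l s
  | for_ B C => force B S l s \/ force C S l s
  | fimp B C => forall S' (q : sub S S'),
      force B S' l (scomp s (lifts l q)) -> force C S' l (scomp s (lifts l q))
  | @fall _ t B => forall S' (q : sub S S') (N : tm (l ++ S') t),
      force B S' l (scons N (scomp s (lifts l q)))
  | @fex _ t B => exists N : tm (l ++ S) t, force B S l (scons N s)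
  | @fnab _ t B => force B S (t :: l) (up s)
  end.
Arguments force {G} B S l s.

Lemma force_sconv G (B : form G) : forall S l (s r : sub G (l ++ S)),
  sconv s r -> force B S l s -> force B S l r.
Proof.
  induction B; intros S l s r H Hf; cbn in *; auto.
  - destruct a; try (eapply holds_sconv; eassumption);
      try (eapply bisim_conv; [ | | eassumption]; apply tsub_sconv; auto).
    eapply conv_trans; [apply tsub_sconv, sconv_sym, H |].
    eapply conv_trans; [exact Hf | apply tsub_sconv, H].
  - destruct Hf; eauto.
  - destruct Hf; eauto.
  - intros S' q HB. eapply IHB2; [apply sconv_scomp_l, H |]. apply Hf.
    eapply IHB1; [| exact HB]. apply sconv_scomp_l, sconv_sym, H.
  - intros S' q N. eapply IHB; [| apply Hf]. apply sconv_scons; [apply conv_refl |].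
    apply sconv_scomp_l, H.
  - destruct Hf as (N & Hf). exists N. eapply IHB; [| exact Hf].
    apply sconv_scons; auto using conv_refl.
  - eapply (IHB S (t :: l)); [| exact Hf]. apply sconv_up, H.
Qed.

Lemma force_mono G (B : form G) : forall S l (s : sub G (l ++ S)) S' (q : sub S S'),
  force B S l s -> force B S' l (scomp s (lifts l q)).
Proof.
  induction B; intros S l s S' q Hf; cbn in *; auto.
  - destruct a; try (apply holds_sub; assumption).
    + rewrite <- !tsub_tsub with (s := s). apply bisim_sub; auto.
    + rewrite <- !tsub_tsub with (s := s). apply bisim_sub; auto.
    + rewrite <- !tsub_tsub with (s := s). apply conv_tsub; auto.
  - destruct Hf; auto.
  - destruct Hf; auto.
  - intros S'' q' HB. rewrite scomp_assoc, lifts_scomp in *. auto.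
  - intros S'' q' N. rewrite scomp_assoc, lifts_scomp in *. auto.
  - destruct Hf as (N & Hf). exists (tsub (lifts l q) N). rewrite <- scomp_scons. auto.
  (* The signatures [(t :: l) ++ S] and [t :: l ++ S] agree by computation only, so rewriting with
     [up_scomp] is spelled out as a term. *)
  - exact (eq_ind _ (force B S' (t :: l)) (IHB S (t :: l) (up s) S' q Hf) _
      (up_scomp t s (lifts l q))).
Qed.

Lemma force_fsub G (B : form G) : forall D (r : sub G D) S l (s : sub D (l ++ S)),
  force (fsub r B) S l s <-> force B S l (scomp r s).
Proof.
  induction B; intros D r S l s; cbn; try tauto.
  - destruct a; cbn; rewrite ?holds_one, ?holds_onep, ?tsub_tsub; tauto.
  - rewrite IHB1, IHB2. tauto.
  - rewrite IHB1, IHB2. tauto.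
  - split; intros H S' q; specialize (H S' q); rewrite IHB1, IHB2, scomp_assoc in *; auto.
  - split; intros H S' q N; specialize (H S' q N); rewrite IHB, up_scons, scomp_assoc in *; auto.
  - split; intros [N H]; exists N; rewrite IHB, up_scons in *; auto.
  - exact (eq_ind _ (fun u => _ <-> force B S (t :: l) u)
      (IHB _ (up r) S (t :: l) (up s)) _ (up_scomp t r s)).
Qed.

Lemma force_fconv G (B C : form G) : fconv B C -> forall S l (s : sub G (l ++ S)),
  force B S l s <-> force C S l s.
Proof.
  induction 1; intros S l s; cbn; try tauto.
  - pose proof (aconv_sym H) as H'.
    pose proof (aconv_asub s H) as Hs. pose proof (aconv_asub s H') as Hs'.
    destruct H; cbn in *;
    try (split; apply holds_atom_conv; assumption);
    try (apply aconv_inv in Hs, Hs'; destruct Hs, Hs'; split; apply bisim_conv; assumption).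
    split; intros Hc.
    + eapply conv_trans; [apply conv_tsub, conv_sym, H |].
      eapply conv_trans; [exact Hc | apply conv_tsub; assumption].
    + eapply conv_trans; [apply conv_tsub, H |].
      eapply conv_trans; [exact Hc | apply conv_tsub, conv_sym; assumption].
  - rewrite IHfconv1, IHfconv2. tauto.
  - rewrite IHfconv1, IHfconv2. tauto.
  - split; intros Hi S' q; specialize (Hi S' q); rewrite IHfconv1, IHfconv2 in *; auto.
  - split; intros Hi S' q N; specialize (Hi S' q N); rewrite IHfconv in *; auto.
  - split; intros [N Hi]; exists N; rewrite IHfconv in *; auto.
  - apply (IHfconv S (t :: l)).
Qed.

Lemma force_horn G (B : form G) : horn B = true -> forall S l (s : sub G (l ++ S)),
  force B S l s <-> holds B s.
Proof.
  induction B; cbn [horn]; intros Hh S l s; try discriminate.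
  - destruct a; try discriminate; cbn; tauto.
  - cbn. split; [intros; apply holds_top | auto].
  - apply andb_prop in Hh. destruct Hh. cbn. rewrite IHB1, IHB2; auto.
    split; [intros []; apply holds_and; auto | apply holds_inv].
  - cbn. split.
    + intros [N H]. eapply holds_ex. apply IHB; eauto.
    + intros H. apply holds_inv in H. destruct H as [N H]. exists N. apply IHB; auto.
  - cbn. rewrite (IHB Hh S (t :: l)). split; [intros; apply holds_nab; auto | apply holds_inv].
Qed.

Definition pi_atom G (A : atom G) : bool :=
  match A with one _ _ _ | onep _ _ _ => true | _ => false end.

Lemma D_pi_horn c : In c D_pi -> horn (cl_body c) = true /\ pi_atom (cl_head c) = true.
Proof.
  revert c. apply Forall_forall. unfold D_pi. repeat constructor.
Qed.

Lemma pi_atom_conv G (A B : atom G) : aconv A B -> pi_atom A = pi_atom B.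
Proof. destruct 1; reflexivity. Qed.

Lemma pi_atom_sub G D (A : atom G) (s : sub G D) : pi_atom (asub s A) = pi_atom A.
Proof. destruct A; reflexivity. Qed.

Definition nosub G : sub [] G := fun t x =>
  match x in var H u return match H with [] => tm G u | _ => unit end with
  | vz => tt
  | vs _ => tt
  end.

(** * The clauses of the two bisimilarities and their meaning in the model *)

Definition bisim_atom (late : bool) G (P Q : tm G tp) : atom G :=
  if late then lbisim P Q else ebisim P Q.

Definition sim_free late G (P Q : tm G tp) : form G :=
  all (fun A : tm _ ta => all (fun P' : tm _ tp =>
    one ⇑⇑P ⇑A P' ⊃ ex (fun Q' : tm _ tp =>
      one ⇑⇑⇑Q ⇑⇑A Q' ⊓ bisim_atom late ⇑P' Q'))).

Definition sim_late G (P Q : tm G tp) : form G :=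
  all (fun X : tm _ tn => all (fun P' : tm _ (tn ~> tp) =>
    onep ⇑⇑P (Dn ⇑X) P' ⊃ ex (fun Q' : tm _ (tn ~> tp) =>
      onep ⇑⇑⇑Q (Dn ⇑⇑X) Q' ⊓
      all (fun w : tm _ tn => lbisim (⇑⇑P' ⋅ w) (⇑Q' ⋅ w))))).

Definition sim_early G (P Q : tm G tp) : form G :=
  all (fun X : tm _ tn => all (fun P' : tm _ (tn ~> tp) =>
    onep ⇑⇑P (Dn ⇑X) P' ⊃ all (fun w : tm _ tn => ex (fun Q' : tm _ (tn ~> tp) =>
      onep ⇑⇑⇑⇑Q (Dn ⇑⇑⇑X) Q' ⊓ ebisim (⇑⇑P' ⋅ ⇑w) (Q' ⋅ ⇑w))))).

Definition sim_out late G (P Q : tm G tp) : form G :=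
  all (fun X : tm _ tn => all (fun P' : tm _ (tn ~> tp) =>
    onep ⇑⇑P (Up ⇑X) P' ⊃ ex (fun Q' : tm _ (tn ~> tp) =>
      onep ⇑⇑⇑Q (Up ⇑⇑X) Q' ⊓
      nab (fun w : tm _ tn => bisim_atom late (⇑⇑P' ⋅ w) (⇑Q' ⋅ w))))).

Definition sim_in (late : bool) G (P Q : tm G tp) : form G :=
  if late then sim_late P Q else sim_early P Q.

Definition sim_body late G (P Q : tm G tp) : form G :=
  sim_free late P Q ⊓ sim_in late P Q ⊓ sim_out late P Q ⊓
  sim_free late Q P ⊓ sim_in late Q P ⊓ sim_out late Q P.

Definition bisim_clause (late : bool) : clause := if late then lbisim_clause else ebisim_clause.

(** Both clauses are literally assembled from the conjuncts above, whence [reflexivity]; apart from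
    the input conjunct, they can then be treated together. *)
Lemma bisim_clause_eq late :
  bisim_clause late = mk_clause [tp; tp] (fun P Q => bisim_atom late P Q ≜ sim_body late P Q).
Proof. destruct late; reflexivity. Qed.

Lemma bisim_atom_sub late G D (s : sub G D) P Q :
  asub s (bisim_atom late P Q) = bisim_atom late (tsub s P) (tsub s Q).
Proof. destruct late; reflexivity. Qed.

Lemma sim_body_sub late G D (s : sub G D) P Q :
  fsub s (sim_body late P Q) = sim_body late (tsub s P) (tsub s Q).
Proof.
  assert (H1 : forall P Q, fsub s (sim_free late P Q) = sim_free late (tsub s P) (tsub s Q)).
  { intros. unfold sim_free, all, ex. cbn -[wk up]. rewrite bisim_atom_sub, !tsub_up_wk.
    reflexivity. }
  assert (H2 : forall P Q, fsub s (sim_in late P Q) = sim_in late (tsub s P) (tsub s Q)).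
  { intros. destruct late; cbn -[wk up]; rewrite !tsub_up_wk; reflexivity. }
  assert (H3 : forall P Q, fsub s (sim_out late P Q) = sim_out late (tsub s P) (tsub s Q)).
  { intros. unfold sim_out, all, ex, nab. cbn -[wk up]. rewrite bisim_atom_sub.
    cbn -[wk up]. rewrite !tsub_up_wk. reflexivity. }
  unfold sim_body. cbn [fsub]. rewrite !H1, !H2, !H3. reflexivity.
Qed.

Lemma force_bisim_atom late G P Q S l (s : sub G (l ++ S)) :
  force (bisim_atom late P Q) S l s <-> bisim late S l (tsub s P) (tsub s Q).
Proof. destruct late; cbn; tauto. Qed.

Ltac simp_sub := cbn -[wk up lifts scomp] in *; rewrite ?holds_one, ?holds_onep in *;
  rewrite ?scomp_idl, ?force_bisim_atom in *;
  repeat (rewrite ?scomp_scons, ?scomp_assoc, ?lifts_scomp, ?tsub_wk, ?tsub_lifts, ?scomp_idl,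
    ?scomp_idr, ?lifts_id, ?tsub_id in *; cbn -[wk up lifts scomp] in *).

Lemma force_sim_free late S l (P Q : tm (l ++ S) tp) :
  force (sim_free late P Q) S l (@idsub _) <->
  forall S' (s : sub S S') A P', step_one (tsub (lifts l s) P) A P' ->
    exists Q', step_one (tsub (lifts l s) Q) A Q' /\ bisim late S' l P' Q'.
Proof.
  unfold sim_free, all, ex.
  destruct late; (split; [intros H S' s A P' HP;
      (* The formula changes world three times, at two quantifiers and at the implication, but
         [simulates] only once: the first change is [s], the others are identities. In the converse
         direction the three changes are composed. *)
      specialize (H _ s A _ (@idsub _) P' _ (@idsub _));
      simp_sub; destruct (H HP) as (Q' & HQ); exists Q'; simp_sub; auto
    | intros H; cbn; intros S1 s1 A S2 s2 P' S3 s3 HP;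
      simp_sub; destruct (H _ _ _ _ HP) as (Q' & HQ); exists Q'; simp_sub; auto]).
Qed.

Lemma force_sim_out late S l (P Q : tm (l ++ S) tp) :
  force (sim_out late P Q) S l (@idsub _) <->
  (forall S' (s : sub S S') X M, step_onep (tsub (lifts l s) P) (Up X) M ->
    exists N, step_onep (tsub (lifts l s) Q) (Up X) N /\
      bisim late S' (tn :: l) (⇑M ⋅ tvar vz) (⇑N ⋅ tvar vz)).
Proof.
  unfold sim_out, all, ex, nab.
  destruct late; (split; [intros H S' s A P' HP;
      specialize (H _ s A _ (@idsub _) P' _ (@idsub _));
      simp_sub; destruct (H HP) as (Q' & HQ); exists Q'; simp_sub; auto
    | intros H; cbn; intros S1 s1 A S2 s2 P' S3 s3 HP;
      simp_sub; destruct (H _ _ _ _ HP) as (Q' & HQ); exists Q'; simp_sub; auto]).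
Qed.

Lemma force_sim_late S l (P Q : tm (l ++ S) tp) :
  force (sim_late P Q) S l (@idsub _) <->
  (forall S' (s : sub S S') X M, step_onep (tsub (lifts l s) P) (Dn X) M ->
    exists N, step_onep (tsub (lifts l s) Q) (Dn X) N /\
      forall S'' (s' : sub S' S'') w,
        bisim true S'' l (tsub (lifts l s') M ⋅ w) (tsub (lifts l s') N ⋅ w)).
Proof.
  unfold sim_late, all, ex, nab. split.
  - intros H S' s A P' HP.
    specialize (H _ s A _ (@idsub _) P' _ (@idsub _)).
    simp_sub. destruct (H HP) as (Q' & HQ & HB). exists Q'. simp_sub. split; auto.
  - intros H. cbn. intros S1 s1 A S2 s2 P' S3 s3 HP.
    simp_sub. destruct (H _ _ _ _ HP) as (Q' & HQ & HB). exists Q'. simp_sub. split; auto.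
Qed.

Lemma force_sim_early S l (P Q : tm (l ++ S) tp) :
  force (sim_early P Q) S l (@idsub _) <->
  (forall S' (s : sub S S') X M, step_onep (tsub (lifts l s) P) (Dn X) M ->
    forall S'' (s' : sub S' S'') w,
    exists N, step_onep (tsub (lifts l (scomp s s')) Q) (Dn (tsub (lifts l s') X)) N /\
      bisim false S'' l (tsub (lifts l s') M ⋅ w) (N ⋅ w)).
Proof.
  unfold sim_early, all, ex, nab. split.
  - intros H S' s A P' HP S'' s' w.
    specialize (H _ s A _ (@idsub _) P' _ (@idsub _)).
    simp_sub. destruct (H HP S'' s' w) as (Q' & HQ). exists Q'. simp_sub. auto.
  - intros H. cbn. intros S1 s1 A S2 s2 P' S3 s3 HP S'' s' w.
    simp_sub. destruct (H _ _ _ _ HP S'' s' w) as (Q' & HQ). exists Q'. simp_sub. auto.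
Qed.

Lemma force_sim_body late S l (P Q : tm (l ++ S) tp) :
  force (sim_body late P Q) S l (@idsub _) <->
  simulates late (@bisim late) S l P Q /\ simulates late (@bisim late) S l Q P.
Proof.
  unfold sim_body. cbn [force].
  rewrite !force_sim_free, !force_sim_out. unfold simulates, sim_in.
  destruct late; [rewrite !force_sim_late | rewrite !force_sim_early];
    intuition discriminate.
Qed.

Lemma force_bisim_clause late S l (r : sub (cl_vars (bisim_clause late)) (l ++ S)) P Q :
  aconv (bisim_atom late P Q) (asub r (cl_head (bisim_clause late))) ->
  force (cl_body (bisim_clause late)) S l r <-> bisim late S l P Q.
Proof.
  revert r. rewrite bisim_clause_eq. intros r.
  change (aconv (bisim_atom late P Q) (asub r (bisim_atom late (tvar vz) (tvar (vs vz)))) ->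
    force (sim_body late (tvar vz) (tvar (vs vz))) S l r <-> bisim late S l P Q).
  rewrite bisim_atom_sub. intros H.
  rewrite <- (scomp_idr r), <- force_fsub, sim_body_sub, force_sim_body.
  cbn in *. set (P' := r _ vz) in *. set (Q' := r _ (vs vz)) in *.
  assert (conv P P' /\ conv Q Q') as [HP HQ].
  { destruct late; exact (aconv_inv H). }
  transitivity (bisim late S l P' Q').
  - split; [intros []; constructor; auto | intros []; auto].
  - split; apply bisim_conv; auto using conv_sym.
Qed.

Lemma D_bisim_cases (P : clause -> Prop) :
  (forall c, In c D_pi -> P c) -> (forall late, P (bisim_clause late)) ->
  (forall t, P (equal_clause t)) -> forall c, D_bisim c -> P c.
Proof.
  intros H1 H2 H3 c [H | [-> | [-> | [t ->]]]]; auto.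
  - apply (H2 true).
  - apply (H2 false).
Qed.

(** With [force_atom_fold], this says that atoms are interpreted by a fixed point of the whole
    definition. Unfolding justifies the left rule for definitions, folding the right rule. *)
Lemma force_atom_unfold G (A : atom G) S l (s : sub G (l ++ S)) :
  force (fatom A) S l s -> exists c (r : sub (cl_vars c) (l ++ S)),
    D_bisim c /\ aconv (asub s A) (asub r (cl_head c)) /\ force (cl_body c) S l r.
Proof.
  intros H.
  assert (Hpi : holds (fatom A) s -> exists c (r : sub (cl_vars c) (l ++ S)),
    D_bisim c /\ aconv (asub s A) (asub r (cl_head c)) /\ force (cl_body c) S l r).
  { intros Hf. apply holds_inv in Hf. destruct Hf as (c & r & Hc & HA & Hf).
    exists c, r. split; [left; auto | split; auto].
    apply force_horn; auto. apply D_pi_horn; auto. }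
  assert (Hbis : forall late P Q, bisim late S l (tsub s P) (tsub s Q) ->
    exists c (r : sub (cl_vars c) (l ++ S)),
    D_bisim c /\ aconv (asub s (bisim_atom late P Q)) (asub r (cl_head c)) /\
    force (cl_body c) S l r).
  { intros late P Q HB. exists (bisim_clause late).
    assert (HD : D_bisim (bisim_clause late)) by (unfold D_bisim; destruct late; auto).
    assert (exists r : sub (cl_vars (bisim_clause late)) (l ++ S),
      asub r (cl_head (bisim_clause late)) = asub s (bisim_atom late P Q)) as [r Hr].
    { rewrite bisim_clause_eq. exists (scons (tsub s P) (scons (tsub s Q) (nosub _))).
      destruct late; reflexivity. }
    exists r. rewrite Hr. split; [auto | split; [apply aconv_refl |]].
    apply (@force_bisim_clause late S l r (tsub s P) (tsub s Q)); auto.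
    rewrite Hr, bisim_atom_sub. apply aconv_refl. }
  destruct A; auto.
  - apply (Hbis true). exact H.
  - apply (Hbis false). exact H.
  - exists (equal_clause t), (scons (tsub s t0) (nosub _)).
    split; [unfold D_bisim; eauto 6 | split; [| exact I]].
    constructor; [apply conv_refl | apply conv_sym, H].
Qed.

Lemma force_atom_fold G (A : atom G) S l (s : sub G (l ++ S)) c (r : sub (cl_vars c) (l ++ S)) :
  D_bisim c -> aconv (asub s A) (asub r (cl_head c)) -> force (cl_body c) S l r ->
  force (fatom A) S l s.
Proof.
  intros Hc. revert c Hc r. apply (D_bisim_cases (fun c => forall r : sub (cl_vars c) (l ++ S),
    aconv (asub s A) (asub r (cl_head c)) -> force (cl_body c) S l r -> force (fatom A) S l s)).
  - intros c Hc r HA Hf. destruct (D_pi_horn Hc) as [Hh Hp].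
    apply force_horn in Hf; auto.
    assert (holds (fatom A) s) by (eapply holds_atom; eauto).
    apply pi_atom_conv in HA. rewrite !pi_atom_sub, Hp in HA.
    destruct A; try discriminate; auto.
  - intros late r HA Hf.
    assert (exists P Q, A = bisim_atom late P Q) as (P & Q & ->).
    { clear Hf. revert r HA. rewrite bisim_clause_eq. intros r HA. apply aconv_inv in HA.
      destruct A, late; try contradiction; try (do 2 eexists; reflexivity);
      destruct HA as (? & ? & ? & ?); discriminate. }
    rewrite bisim_atom_sub in HA. apply force_bisim_atom.
    apply (@force_bisim_clause late S l r _ _ HA). auto.
  - intros t r HA _. apply aconv_inv in HA. destruct A; try contradiction. cbn in *.
    destruct HA as (M & N & HE & HM & HN).
    assert (conv M N); [| eapply conv_trans; [eassumption |];
      eapply conv_trans; [eassumption | apply conv_sym; assumption]].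
    (* [HE] equates two [equal] atoms whose argument types are hidden. A predicate on atoms carries
       convertibility across it, without injectivity of dependent pairs. *)
    assert (Heq : forall u (a : tm (l ++ S) u) (B : atom (l ++ S)), B = equal a a ->
      match B with equal x y => conv x y | _ => True end)
      by (intros ? ? ? ->; apply conv_refl).
    apply (Heq _ _ _ (eq_sym HE)).
Qed.

(** * Soundness *)

Definition force_jdg S (J : jdg S) S' (s : sub S S') : Prop :=
  force (jform J) S' (jloc J) (lifts (jloc J) s).

Definition force_ctx S (Gam : list (jdg S)) S' (s : sub S S') : Prop :=
  forall J, In J Gam -> force_jdg J s.

Definition valid S (Gam : list (jdg S)) (K : jdg S) : Prop :=
  forall S' (s : sub S S'), force_ctx Gam s -> force_jdg K s.

Lemma force_ctx_cons S (J : jdg S) Gam S' (s : sub S S') :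
  force_ctx (J :: Gam) s <-> force_jdg J s /\ force_ctx Gam s.
Proof.
  unfold force_ctx. cbn. split.
  - auto.
  - intros [H1 H2] K [<- | HK]; auto.
Qed.

Lemma force_ctx_app S (Gam Del : list (jdg S)) S' (s : sub S S') :
  force_ctx (Gam ++ Del) s <-> force_ctx Gam s /\ force_ctx Del s.
Proof.
  unfold force_ctx. split.
  - intros H. split; intros; apply H, in_or_app; auto.
  - intros [H1 H2] J HJ. apply in_app_or in HJ. destruct HJ; auto.
Qed.

Lemma force_jdg_jsub S S' S'' (s : sub S S') (r : sub S' S'') J :
  force_jdg (jsub s J) r <-> force_jdg J (scomp s r).
Proof.
  unfold force_jdg, jsub. cbn. rewrite force_fsub, lifts_scomp. tauto.
Qed.

Lemma force_ctx_jsub S S' S'' (s : sub S S') (r : sub S' S'') Gam :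
  force_ctx (map (jsub s) Gam) r <-> force_ctx Gam (scomp s r).
Proof.
  unfold force_ctx. split; intros H J HJ.
  - apply force_jdg_jsub, H, in_map, HJ.
  - apply in_map_iff in HJ. destruct HJ as (K & <- & HK). apply force_jdg_jsub; auto.
Qed.

Lemma force_jdg_mono S S' S'' (s : sub S S') (r : sub S' S'') J :
  force_jdg J s -> force_jdg J (scomp s r).
Proof. unfold force_jdg. rewrite <- lifts_scomp. apply force_mono. Qed.

Lemma force_ctx_mono S S' S'' (s : sub S S') (r : sub S' S'') Gam :
  force_ctx Gam s -> force_ctx Gam (scomp s r).
Proof. intros H J HJ. apply force_jdg_mono; auto. Qed.

Lemma force_jdg_jconv S (J K : jdg S) S' (s : sub S S') :
  jconv J K -> force_jdg J s <-> force_jdg K s.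
Proof. intros (l & B & C & -> & -> & H). apply force_fconv; auto. Qed.

Lemma eigen_sconv S l t S' (s : sub S S') (N : tm (l ++ S') t) :
  sconv (scomp (scons (app_loc l (vz : var (raise l t :: S) (raise l t)))
                      (lifts l (@wksub S (raise l t))))
               (lifts l (scons (raise_lam l N) s)))
        (scons N (lifts l s)).
Proof.
  rewrite scomp_scons, lifts_scomp, wk_scons. apply sconv_scons; [| apply sconv_refl].
  rewrite tsub_app_loc. apply raise_app_raise_lam.
Qed.

Lemma force_eigen S l t (B : form (t :: l ++ S)) S' (s : sub S S') (N : tm (l ++ S') t) :
  force (eigen l B) S' l (lifts l (scons (raise_lam l N) s)) <-> force B S' l (scons N (lifts l s)).
Proof.
  unfold eigen. rewrite force_fsub. split; apply force_sconv;
    [| apply sconv_sym]; apply eigen_sconv.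
Qed.

Lemma force_inst G t (B : form (t :: G)) N S l (s : sub G (l ++ S)) :
  force (inst B N) S l s <-> force B S l (scons (tsub s N) s).
Proof. unfold inst. rewrite force_fsub, scomp_scons. tauto. Qed.

Fixpoint unraise (l xs : ctx) D : sub xs (l ++ D) -> sub (raised l xs) D :=
  match xs return sub xs (l ++ D) -> sub (raised l xs) D with
  | [] => fun _ => @nosub D
  | t :: xs' => fun s => scons (raise_lam l (s _ vz)) (unraise l D (fun _ x => s _ (vs x)))
  end.
Arguments unraise l {xs D} s.

Lemma unraise_var l xs t (x : var xs t) : forall D (s : sub xs (l ++ D)),
  unraise l s _ (raise_var l x) = raise_lam l (s _ x).
Proof. induction x; intros; cbn; auto. Qed.

(** Every instance of a clause over the local signature comes from an instance of the raised clause,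
    so the raised clauses of the left and right rules cover all instances. *)
Lemma raise_unraise l xs D (s : sub xs (l ++ D)) :
  sconv (scomp (@raise_sub l xs) (lifts l (unraise l s))) s.
Proof.
  intros t x. unfold scomp, raise_sub. rewrite tsub_app_loc, unraise_var.
  apply raise_app_raise_lam.
Qed.

(** Validity quantifies over all later worlds, so cut is mere composition, and an eigenvariable is
    handled by moving to the world where it becomes the raised form of the term at hand. *)
Lemma sound S (Gam : list (jdg S)) K : der D_bisim Gam K -> valid Gam K.
Proof.
  induction 1; intros S' q HG.
  - apply HG. left; auto.
  - apply force_ctx_app in HG. destruct HG. apply IHder2, force_ctx_cons. auto.
  - apply IHder. intros J' HJ. apply HG. eapply Permutation_in; eauto.
  - apply force_ctx_cons in HG. destruct HG. apply IHder, force_ctx_cons. split; auto.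
    apply (force_jdg_jconv q H). auto.
  - apply (force_jdg_jconv q H). auto.
  - apply force_ctx_cons in HG. apply IHder; tauto.
  - apply force_ctx_cons in HG. apply IHder, force_ctx_cons. rewrite force_ctx_cons. tauto.
  - exact I.
  - apply force_ctx_cons in HG. destruct HG as [[] _].
  - apply force_ctx_cons in HG. destruct HG as [[] ?]. apply IHder. rewrite !force_ctx_cons. auto.
  - split; [apply IHder1 | apply IHder2]; auto.
  - apply force_ctx_cons in HG. destruct HG as [[HB | HC] ?];
      [apply IHder1 | apply IHder2]; rewrite force_ctx_cons; auto.
  - left. apply IHder; auto.
  - right. apply IHder; auto.
  - apply force_ctx_cons in HG. destruct HG as [HI HG].
    apply IHder2, force_ctx_cons. split; auto.
    specialize (HI S' (@idsub S')). cbn in HI. rewrite lifts_scomp, scomp_idr in HI.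
    apply HI. apply (IHder1 S' q). auto.
  - intros S'' q' HB. cbn in *. rewrite lifts_scomp in *.
    apply (IHder S'' (scomp q q')), force_ctx_cons. split; auto. apply force_ctx_mono; auto.
  - apply force_ctx_cons in HG. destruct HG as [HI HG].
    apply IHder, force_ctx_cons. split; auto.
    apply force_inst. specialize (HI S' (@idsub S')). cbn in HI.
    rewrite lifts_scomp, scomp_idr in HI. apply HI.
  - intros S'' q' N. cbn in *. rewrite lifts_scomp.
    apply force_eigen. apply (IHder S'' (scons (raise_lam l N) (scomp q q'))).
    rewrite force_ctx_jsub, wk_scons. apply force_ctx_mono; auto.
  - apply force_ctx_cons in HG. destruct HG as [[N HB] HG].
    specialize (IHder S' (scons (raise_lam l N) q)).
    rewrite force_ctx_cons, force_ctx_jsub, force_jdg_jsub, wk_scons in IHder.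
    apply IHder. split; auto. apply force_eigen. auto.
  - exists (tsub (lifts l q) N). apply force_inst. apply (IHder S' q). auto.
  - apply force_ctx_cons in HG. destruct HG. apply IHder. rewrite force_ctx_cons. auto.
  - apply (IHder S' q). auto.
  - apply force_ctx_cons in HG. destruct HG as [HA HG].
    apply force_atom_unfold in HA. cbn [jloc] in HA. destruct HA as (c & r & Hc & HA & HB).
    destruct (H c Hc) as [_ Hcsu].
    pose proof (@raise_unraise l (cl_vars c) S' r) as Hr.
    (* The clause instance that forces the atom, once raised, is a unifier together with [q].
       Completeness factors it through a member of the given set; the premise for that member is
       used at the world reached by [d]. *)
    destruct (Hcsu S' q (unraise l r)) as (S0 & s0 & r0 & d & HU & Hs & Hr0).
    { unfold unifier, raised_head. rewrite asub_asub.
      eapply aconv_trans; [exact HA |]. apply asub_sconv, sconv_sym, Hr. }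
    assert (Hsd : forall J, force_jdg J q <-> force_jdg J (scomp s0 d)).
    { intros J. unfold force_jdg. split; apply force_sconv; apply sconv_lifts; auto.
      apply sconv_sym; auto. }
    apply Hsd. apply force_jdg_jsub. apply (H1 c Hc S0 s0 r0 HU).
    apply force_ctx_cons. split.
    + unfold force_jdg, raised_body. cbn. rewrite !force_fsub.
      eapply force_sconv; [| exact HB].
      intros t x.
      eapply conv_trans; [apply conv_sym, Hr |].
      eapply conv_trans; [apply sconv_scomp_r, sconv_lifts, Hr0 |].
      rewrite lifts_scomp. apply conv_refl.
    + apply force_ctx_jsub. intros J HJ. apply Hsd. auto.
  - unfold force_jdg. cbn [jloc jform].
    eapply force_atom_fold
      with (r := scomp (@raise_sub l (cl_vars c)) (scomp (lifts l r) (lifts l q))); eauto.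
    + rewrite <- (asub_asub (cl_head c)), <- (asub_asub _ (lifts l r)).
      apply aconv_asub. auto.
    + specialize (IHder S' q HG). unfold force_jdg, raised_body in IHder.
      cbn [jloc jform] in IHder.
      rewrite !force_fsub in IHder. exact IHder.
Qed.

(** * Sizes of processes *)

(* A model in which names carry no information: sizes are invariant under
   conversion, so that no normal forms are needed to measure processes. *)
Fixpoint size_dom (t : ty) : Type :=
  match t with
  | tn | ta => unit
  | tp => nat
  | arr a b => size_dom a -> size_dom b
  end.

Fixpoint size_dflt (t : ty) : size_dom t :=
  match t with
  | tn | ta => tt
  | tp => 0
  | arr a b => fun _ => size_dflt b
  end.

Definition env (G : ctx) := forall t, var G t -> size_dom t.

Definition env_cons G a (v : size_dom a) (e : env G) : env (a :: G) :=
  fun t x =>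
    match x in var H u
      return match H with [] => Empty_set | b :: H' => size_dom b -> env H' -> size_dom u end
    with
    | vz => fun v _ => v
    | vs y => fun _ e => e _ y
    end v e.

Definition size_cst t (c : cst t) : size_dom t :=
  match c in cst t return size_dom t with
  | c_nil => 1
  | c_tau => fun p => S p
  | c_plus => fun p q => S (p + q)
  | c_par => fun p q => S (p + q)
  | c_match => fun _ _ p => S p
  | c_out => fun _ _ p => S p
  | c_in => fun _ m => S (m tt)
  | c_nu => fun m => S (m tt)
  | c_atau => tt
  | c_dn => fun _ _ => tt
  | c_up => fun _ _ => tt
  end.

Fixpoint size G t (M : tm G t) : env G -> size_dom t :=
  match M with
  | tvar x => fun e => e _ x
  | tcst c => fun _ => size_cst c
  | tapp M N => fun e => size M e (size N e)
  | tlam M => fun e v => size M (env_cons v e)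
  end.

Lemma env_ext_cons a G (e f : env (a :: G)) :
  e _ vz = f _ vz -> (forall t x, e t (vs x) = f t (vs x)) -> e = f.
Proof.
  intros Hz Hs. apply functional_extensionality_dep. intros t.
  apply functional_extensionality. apply (var_case (fun t x => e t x = f t x)); auto.
Qed.

Definition env_sub G D (s : sub G D) (e : env D) : env G := fun t x => size (s t x) e.

Lemma size_tren G t (M : tm G t) : forall D (r : ren G D) (e : env D),
  size (tren r M) e = size M (fun _ x => e _ (r _ x)).
Proof.
  induction M; intros; cbn; auto.
  - rewrite IHM1, IHM2. auto.
  - apply functional_extensionality. intros v. rewrite IHM. f_equal. apply env_ext_cons; auto.
Qed.

Lemma env_sub_up G D a (s : sub G D) (v : size_dom a) e :
  env_sub (up s) (env_cons v e) = env_cons v (env_sub s e).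
Proof.
  apply env_ext_cons; auto. intros t x. unfold env_sub. cbn. unfold wk. apply size_tren.
Qed.

Lemma size_tsub G t (M : tm G t) : forall D (s : sub G D) (e : env D),
  size (tsub s M) e = size M (env_sub s e).
Proof.
  induction M; intros; cbn; auto.
  - rewrite IHM1, IHM2. auto.
  - apply functional_extensionality. intros v. rewrite IHM. f_equal. apply env_sub_up.
Qed.

Lemma env_sub_scons G D a (N : tm D a) (s : sub G D) e :
  env_sub (scons N s) e = env_cons (size N e) (env_sub s e).
Proof. apply env_ext_cons; auto. Qed.

Lemma size_conv G t (M N : tm G t) : conv M N -> forall e, size M e = size N e.
Proof.
  induction 1; intros; cbn; auto.
  - etransitivity; eauto.
  - rewrite IHconv1, IHconv2. auto.
  - apply functional_extensionality. intros v. auto.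
  - rewrite size_tsub, env_sub_scons. reflexivity.
  - apply functional_extensionality. intros v. unfold wk. rewrite size_tren. reflexivity.
Qed.

Lemma env_eta a G (e : env (a :: G)) : e = env_cons (e _ vz) (fun t x => e t (vs x)).
Proof. apply env_ext_cons; auto. Qed.

(* Every process that occurs as the source of a transition in the formula has
   size less than [n]; formulas that are not of the shape of a body of D_pi are
   excluded. *)
Fixpoint bounded_procs (n : nat) G (B : form G) : env G -> Prop :=
  match B with
  | fatom (one P _ _) | fatom (onep P _ _) => fun e => size P e < n
  | ftop => fun _ => True
  | fand B C => fun e => bounded_procs n B e /\ bounded_procs n C e
  | @fex _ t B | @fnab _ t B => fun e => forall v : size_dom t, bounded_procs n B (env_cons v e)
  | _ => fun _ => False
  end.

(** In [bounded_procs] an existential formula stands on the left of a sequent, so its witness is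
    arbitrary; here the formula is known to hold, so only some witness has to be measured. *)
Fixpoint decreasing G (B : form G) : env G -> Prop :=
  match B with
  | fatom (one P _ Q) => fun e => size Q e < size P e
  | fatom (onep P _ M) => fun e => size M e tt < size P e
  | fand B C => fun e => decreasing B e /\ decreasing C e
  | @fex _ t B => fun e => exists v : size_dom t, decreasing B (env_cons v e)
  | @fnab _ t B => fun e => forall v : size_dom t, decreasing B (env_cons v e)
  | _ => fun _ => True
  end.

(** The drop from [S n] to [n] is what allows [left_analysis] to recurse into the bodies of
    clauses. *)
Lemma D_pi_bound c : In c D_pi -> forall n e,
  bounded_procs (S n) (fatom (cl_head c)) e -> bounded_procs n (cl_body c) e.
Proof.
  revert c. apply (proj1 (Forall_forall (fun c => forall n (e : env (cl_vars c)),
    bounded_procs (S n) (fatom (cl_head c)) e -> bounded_procs n (cl_body c) e) D_pi)).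
  unfold D_pi. repeat apply Forall_cons; [.. | apply Forall_nil];
    unfold mk_clause, nab, ex, lam; cbn; intros; repeat split; try lia;
  repeat match goal with v : unit |- _ => destruct v end; try lia.
Qed.

(** The tight case is scope extrusion, which creates a restriction: each of the two components has
    lost at least one, and this pays for the new constructor with a strict decrease left over. *)
Lemma D_pi_dec c : In c D_pi -> forall e,
  decreasing (cl_body c) e -> decreasing (fatom (cl_head c)) e.
Proof.
  revert c. apply (proj1 (Forall_forall (fun c => forall (e : env (cl_vars c)),
    decreasing (cl_body c) e -> decreasing (fatom (cl_head c)) e) D_pi)).
  unfold D_pi. repeat apply Forall_cons; [.. | apply Forall_nil];
    unfold mk_clause, nab, ex, lam; cbn; intros;
  repeat match goal with H : exists _, _ |- _ => destruct H end;
  repeat match goal with H : unit -> _ |- _ => specialize (H tt) end; try lia.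
  (* Free communication applies the continuation to the variable [Y]; its value lies in [unit],
     hence is [tt]. *)
  all: match goal with |- context [?f tn ?x] => destruct (f tn x) end; lia.
Qed.

Lemma decreasing_aconv G D E (A : atom G) (A' : atom D) (s : sub G E) (r : sub D E) (e : env E) :
  aconv (asub s A) (asub r A') ->
  decreasing (fatom A') (env_sub r e) -> decreasing (fatom A) (env_sub s e).
Proof.
  intros H. apply aconv_inv in H. destruct A, A'; cbn in *; try tauto;
    destruct H as (HP & _ & HQ); apply size_conv with (e := e) in HP;
    apply size_conv with (e := e) in HQ; rewrite !size_tsub in *; rewrite HP, HQ; auto.
Qed.

Lemma bounded_procs_aconv n G D E (A : atom G) (A' : atom D) (s : sub G E) (r : sub D E) (e :
  env E) :
  aconv (asub s A) (asub r A') ->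
  bounded_procs n (fatom A) (env_sub s e) -> bounded_procs n (fatom A') (env_sub r e).
Proof.
  intros H. apply aconv_inv in H. destruct A, A'; cbn in *; try tauto;
    destruct H as (HP & _ & _); apply size_conv with (e := e) in HP;
    rewrite !size_tsub in *; rewrite HP; auto.
Qed.

Lemma holds_dec G (B : form G) D (s : sub G D) :
  holds B s -> forall e, decreasing B (env_sub s e).
Proof.
  induction 1; intros e; cbn [decreasing]; auto.
  - exists (size N e). rewrite <- env_sub_scons. auto.
  - intros v. rewrite <- env_sub_up. auto.
  - eapply decreasing_aconv; [eassumption |]. apply D_pi_dec; auto.
Qed.

Definition bounded n G (P : tm G tp) : Prop := forall e, size P e < n.

Lemma bounded_le m n G (P : tm G tp) : m <= n -> bounded m P -> bounded n P.
Proof. intros H HP e. specialize (HP e). cbn in *. lia. Qed.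

Lemma bounded_conv n G (P Q : tm G tp) : conv P Q -> bounded n P -> bounded n Q.
Proof. intros H HP e. rewrite <- (size_conv H). apply HP. Qed.

Lemma bounded_sub n G D (s : sub G D) P : bounded n P -> bounded n (tsub s P).
Proof. intros HP e. rewrite size_tsub. apply HP. Qed.

Lemma bounded_step_one n G (P : tm G tp) A Q : step_one P A Q -> bounded (S n) P -> bounded n Q.
Proof.
  intros H HP e. specialize (HP e). pose proof (holds_dec H e) as Hd. cbn in Hd.
  change (env_sub (@idsub G) e) with e in Hd. lia.
Qed.

Lemma bounded_step_onep n G (P : tm G tp) A M w :
  step_onep P A M -> bounded (S n) P -> bounded n (M ⋅ w).
Proof.
  intros H HP e. specialize (HP e). pose proof (holds_dec H e) as Hd. cbn in *.
  change (env_sub (@idsub G) e) with e in Hd. destruct (size w e). lia.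
Qed.

Lemma bounded_step_onep_wk n G (P : tm G tp) A M :
  step_onep P A M -> bounded (S n) P -> bounded n (⇑M ⋅ tvar vz : tm (tn :: G) tp).
Proof.
  intros H HP. rewrite wk_sub.
  exact (bounded_step_onep _ (step_onep_sub _ H) (bounded_sub _ HP)).
Qed.

Lemma bounded_0 G (P : tm G tp) : ~ bounded 0 P.
Proof.
  intros H. specialize (H (fun t _ => size_dflt t)). lia.
Qed.

(** The free variables of an encoded process are names, whose values lie in [unit]; so the size does
    not depend on the environment, and one environment gives a bound for all. *)
Lemma size_enc k (P : proc k) : exists n, bounded n (enc P).
Proof.
  assert (H : forall e f, size (enc P) e = size (enc P) f).
  { induction P; intros e f; cbn; auto. }
  exists (S (size (enc P) (fun t _ => size_dflt t))). intros e.
  rewrite (H e (fun t _ => size_dflt t)). lia.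
Qed.

Lemma env_sub_scomp G D E (s : sub G D) (r : sub D E) e :
  env_sub (scomp s r) e = env_sub s (env_sub r e).
Proof.
  apply functional_extensionality_dep. intros t. apply functional_extensionality. intros x.
  apply size_tsub.
Qed.

(** * Case analysis of transitions in the antecedent *)

Lemma csu_all S l (A : atom (l ++ S)) c : csu l A c (fun S' s r => unifier l A c s r).
Proof.
  split; auto. intros S' s r H. exists S', s, r, (@idsub S').
  split; auto. rewrite !scomp_idr. split; apply sconv_refl.
Qed.

(** The formula on the left disappears altogether: each way in which it can hold acts on the rest of
    the sequent only through a substitution [q]. The outer induction is on the size bound, the inner
    one on the formula, because the body of a clause is not a subformula of an atom. *)
Lemma left_analysis n : forall G (B : form G) S l (s : sub G (l ++ S)) Gam (K : jdg S),
  (forall e, bounded_procs n B (env_sub s e)) ->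
  (forall S' (q : sub S S'), holds B (scomp s (lifts l q)) ->
     der D_bisim (map (jsub q) Gam) (jsub q K)) ->
  der D_bisim ((l ▷ fsub s B) :: Gam) K.
Proof.
  induction n as [n IHn] using (well_founded_induction Wf_nat.lt_wf).
  intros G B. induction B; intros S l s Gam K Hb H; cbn [fsub].
  - apply d_defL with (U := fun c S' q r => unifier l (asub s a) c q r).
    { intros; apply csu_all. }
    assert (Hpi : pi_atom a = true).
    { specialize (Hb (fun t _ => size_dflt t)). destruct a; auto. }
    intros c Hc. pattern c. revert c Hc. apply D_bisim_cases.
    + intros c Hc S' q r HU. unfold unifier, raised_head in HU. rewrite !asub_asub in HU.
      destruct n as [| n].
      { exfalso. specialize (Hb (fun t _ => size_dflt t)).
        destruct a; try discriminate; cbn in Hb; lia. }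
      unfold raised_body. rewrite fsub_fsub.
      apply (IHn n); auto.
      * intros e. apply D_pi_bound; auto. eapply bounded_procs_aconv; [exact HU |].
        rewrite env_sub_scomp. apply Hb.
      * intros S'' q' Hf. rewrite map_jsub_jsub, jsub_jsub. apply H.
        eapply holds_atom; [exact Hc | | exact Hf].
        rewrite <- lifts_scomp, <- scomp_assoc.
        rewrite <- (asub_asub _ (scomp s _)), <- (asub_asub _ (scomp _ (lifts l r))).
        apply aconv_asub. exact HU.
    + intros late. rewrite bisim_clause_eq. intros S' q r HU. unfold unifier, raised_head in HU.
      apply pi_atom_conv in HU. rewrite !pi_atom_sub, Hpi in HU. destruct late; discriminate.
    + intros t S' q r HU. unfold unifier, raised_head in HU.
      apply pi_atom_conv in HU. rewrite !pi_atom_sub, Hpi in HU. discriminate.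
  - apply d_weak. specialize (H S (@idsub S)). rewrite map_jsub_id, jsub_id in H.
    apply H, holds_top.
  - exfalso. exact (Hb (fun t _ => size_dflt t)).
  - apply d_andL. apply IHB1; [intros; apply Hb |]. intros S' q HB. cbn [map].
    unfold jsub at 1. cbn [jloc jform]. rewrite fsub_fsub.
    apply IHB2; [intros; rewrite env_sub_scomp; apply Hb |]. intros S'' q' HC.
    rewrite map_jsub_jsub, jsub_jsub. apply H. rewrite scomp_assoc, lifts_scomp in HC.
    (* The first conjunct was solved in an earlier world; its truth is carried along the
       substitution found for the second. *)
    apply holds_and; auto. rewrite <- lifts_scomp, <- scomp_assoc. apply holds_sub; auto.
  - exfalso. exact (Hb (fun t _ => size_dflt t)).
  - exfalso. exact (Hb (fun t _ => size_dflt t)).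
  - exfalso. exact (Hb (fun t _ => size_dflt t)).
  - apply d_exL. unfold eigen. rewrite fsub_fsub, up_scons. apply IHB.
    + intros e. rewrite env_sub_scons, env_sub_scomp. apply Hb.
    + intros S' q HB. rewrite map_jsub_jsub, jsub_jsub. apply H.
      rewrite scomp_scons, scomp_assoc, lifts_scomp in HB. eapply holds_ex; eauto.
  - apply d_nabL. apply (IHB S (t :: l) (up s)).
    + intros e. rewrite (env_eta e).
      refine (eq_ind _ (bounded_procs n B) _ _ (eq_sym (@env_sub_up _ _ _ _ _ _))). apply Hb.
    + intros S' q HB. apply H. apply holds_nab. rewrite <- up_scomp. exact HB.
Qed.

(** * Completeness *)

Lemma der_conv S (Gam : list (jdg S)) l (B C : form (l ++ S)) :
  fconv B C -> der D_bisim Gam (l ▷ B) -> der D_bisim Gam (l ▷ C).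
Proof. intros H. apply d_convR. exists l, B, C. auto. Qed.

Lemma der_fold S (Gam : list (jdg S)) l (A : atom (l ++ S)) c (r : sub (cl_vars c) (l ++ S)) :
  D_bisim c -> aconv A (asub r (cl_head c)) -> der D_bisim Gam (l ▷ fsub r (cl_body c)) ->
  der D_bisim Gam (l ▷ fatom A).
Proof.
  intros Hc HA HB. pose proof (@raise_unraise l (cl_vars c) S r) as Hr.
  apply d_defR with (c := c) (r := unraise l r); auto.
  - unfold raised_head. rewrite asub_asub. eapply aconv_trans; [exact HA |].
    apply asub_sconv, sconv_sym, Hr.
  - unfold raised_body. rewrite fsub_fsub. eapply der_conv; [| exact HB].
    apply fconv_fsub_sconv, sconv_sym, Hr.
Qed.

(** The premise ranges over all instances so as to have the shape of forcing; it is used at a single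
    one, the raised eigenvariable in the extended signature. *)
Lemma der_all S (Gam : list (jdg S)) l G t (s : sub G (l ++ S)) (B : form (t :: G)) :
  (forall S' (q : sub S S') (N : tm (l ++ S') t),
    der D_bisim (map (jsub q) Gam) (l ▷ fsub (scons N (scomp s (lifts l q))) B)) ->
  der D_bisim Gam (l ▷ fsub s (fall B)).
Proof.
  intros H. apply d_allR. unfold eigen. rewrite fsub_fsub, up_scons. apply H.
Qed.

Lemma der_ex S (Gam : list (jdg S)) l G t (s : sub G (l ++ S)) (B : form (t :: G)) N :
  der D_bisim Gam (l ▷ fsub (scons N s) B) -> der D_bisim Gam (l ▷ fsub s (fex B)).
Proof.
  intros H. apply d_exR with (N := N). unfold inst. rewrite fsub_fsub, up_scons, scomp_idr. auto.
Qed.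

Lemma der_and S (Gam : list (jdg S)) l G (s : sub G (l ++ S)) (B C : form G) :
  der D_bisim Gam (l ▷ fsub s B) -> der D_bisim Gam (l ▷ fsub s C) ->
  der D_bisim Gam (l ▷ fsub s (fand B C)).
Proof. apply d_andR. Qed.

Lemma der_nab S (Gam : list (jdg S)) l G t (s : sub G (l ++ S)) (B : form (t :: G)) :
  der D_bisim Gam (t :: l ▷ fsub (up s) B) -> der D_bisim Gam (l ▷ fsub s (fnab B)).
Proof. apply d_nabR. Qed.

Lemma der_imp n S (Gam : list (jdg S)) l G (s : sub G (l ++ S)) (B C : form G) :
  (forall e, bounded_procs n B (env_sub s e)) ->
  (forall S' (q : sub S S'), holds B (scomp s (lifts l q)) ->
    der D_bisim (map (jsub q) Gam) (l ▷ fsub (scomp s (lifts l q)) C)) ->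
  der D_bisim Gam (l ▷ fsub s (fimp B C)).
Proof.
  intros Hb H. apply d_impR. apply left_analysis with (n := n); auto.
  intros S' q HB. unfold jsub at 2. cbn [jloc jform]. rewrite fsub_fsub. auto.
Qed.

(** [holds] forgets where the local signature ends. The equation [E] keeps the context a variable
    for the induction while still choosing a split, which grows to [t :: l] under a nabla. *)
Lemma der_holds G (B : form G) D (s : sub G D) : holds B s ->
  forall S l (E : D = l ++ S) Gam, der D_bisim Gam (l ▷ fsub (eq_rect D (sub G) s _ E) B).
Proof.
  induction 1; intros S l E Gam; subst; cbn [eq_rect].
  - apply d_topR.
  - apply d_andR; [apply (IHholds1 S l eq_refl) | apply (IHholds2 S l eq_refl)].
  - eapply der_ex. apply (IHholds S l eq_refl).
  - apply d_nabR. apply (IHholds S (t :: l) eq_refl).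
  - apply der_fold with (c := c) (r := r); [left; auto | auto |].
    apply (IHholds S l eq_refl).
Qed.

Lemma der_step_one S (Gam : list (jdg S)) l P A Q :
  step_one P A Q -> der D_bisim Gam (l ▷ fatom (one P A Q)).
Proof. intros H. rewrite <- (fsub_id (fatom _)). apply (der_holds H l eq_refl). Qed.

Lemma der_step_onep S (Gam : list (jdg S)) l P A Q :
  step_onep P A Q -> der D_bisim Gam (l ▷ fatom (onep P A Q)).
Proof. intros H. rewrite <- (fsub_id (fatom _)). apply (der_holds H l eq_refl). Qed.

Ltac simp_at H :=
  cbn -[wk up lifts scomp] in H; rewrite ?holds_one, ?holds_onep in H;
  repeat (rewrite ?scomp_scons, ?scomp_assoc, ?lifts_scomp, ?tsub_wk, ?tsub_lifts, ?scomp_idl,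
    ?scomp_idr, ?lifts_id, ?tsub_id in H; cbn -[wk up lifts scomp] in H).

Lemma bounded_procs_one n G D (s : sub G D) P A Q :
  bounded n (tsub s P) -> forall e, bounded_procs n (fatom (one P A Q)) (env_sub s e).
Proof. intros H e. cbn. rewrite <- size_tsub. apply H. Qed.

Lemma bounded_procs_onep n G D (s : sub G D) P A Q :
  bounded n (tsub s P) -> forall e, bounded_procs n (fatom (onep P A Q)) (env_sub s e).
Proof. intros H e. cbn. rewrite <- size_tsub. apply H. Qed.

(** Each semantic solution of the transition in the antecedent has an answer by [simulates], which
    is the witness for the existential; the derivatives fall under the bound [n] of the
    hypothesis. *)
Lemma der_half late n S l (P Q : tm (l ++ S) tp) :
  (forall S l (P Q : tm (l ++ S) tp),
    bounded n P -> bounded n Q -> bisim late S l P Q ->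
    der D_bisim [] (l ▷ fatom (bisim_atom late P Q))) ->
  bounded (Datatypes.S n) P -> bounded (Datatypes.S n) Q ->
  simulates late (@bisim late) S l P Q ->
  der D_bisim [] (l ▷ sim_free late P Q) /\ der D_bisim [] (l ▷ sim_in late P Q) /\
  der D_bisim [] (l ▷ sim_out late P Q).
Proof.
  intros IHn HP HQ (H1 & H2 & H3 & H4). split; [| split].
  - rewrite <- (fsub_id (sim_free late P Q)). unfold sim_free, all, ex.
    apply der_all. intros S1 q1 A. apply der_all. intros S2 q2 P'.
    apply der_imp with (n := Datatypes.S n);
      [apply bounded_procs_one; simp_sub; apply bounded_sub; auto |].
    (* The answer is requested only in the world [S3], after the transition has been analysed: the
       witness may depend on the unifiers by which the transition arose. *)
    intros S3 q3 Hf. simp_at Hf. destruct (H1 _ _ _ _ Hf) as (Q' & HQ' & HB).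
    apply der_ex with (N := Q'). apply der_and.
    + simp_sub. apply der_step_one. auto.
    + cbn [fsub]. rewrite bisim_atom_sub. simp_sub. apply IHn; auto.
      * eapply bounded_step_one; [exact Hf | apply bounded_sub; auto].
      * eapply bounded_step_one; [exact HQ' | apply bounded_sub; auto].
  - destruct late.
    + rewrite <- (fsub_id (sim_in true P Q)). unfold sim_in, sim_late, all, ex.
      apply der_all. intros S1 q1 X. apply der_all. intros S2 q2 P'.
      apply der_imp with (n := Datatypes.S n);
        [apply bounded_procs_onep; simp_sub; apply bounded_sub; auto |].
      intros S3 q3 Hf. simp_at Hf. destruct (H2 eq_refl _ _ _ _ Hf) as (Q' & HQ' & HB).
      apply der_ex with (N := Q'). apply der_and.
      * simp_sub. apply der_step_onep. auto.
      * apply der_all. intros S4 q4 w. specialize (HB _ q4 w). simp_sub. apply (IHn S4); auto.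
        -- pose proof (step_onep_sub (lifts l q4) Hf) as Hf'. rewrite !tsub_lifts in Hf'.
           eapply bounded_step_onep; [exact Hf' | apply bounded_sub, HP].
        -- eapply bounded_step_onep; [exact (step_onep_sub (lifts l q4) HQ') |].
           apply bounded_sub, bounded_sub, HQ.
    + rewrite <- (fsub_id (sim_in false P Q)). unfold sim_in, sim_early, all, ex.
      apply der_all. intros S1 q1 X. apply der_all. intros S2 q2 P'.
      apply der_imp with (n := Datatypes.S n);
        [apply bounded_procs_onep; simp_sub; apply bounded_sub; auto |].
      intros S3 q3 Hf. simp_at Hf. apply der_all. intros S4 q4 w.
      destruct (H3 eq_refl _ _ _ _ Hf _ q4 w) as (Q' & HQ' & HB).
      apply der_ex with (N := Q'). apply der_and.
      * simp_sub. apply der_step_onep. auto.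
      * simp_sub. apply (IHn S4); auto.
        -- pose proof (step_onep_sub (lifts l q4) Hf) as Hf'. rewrite !tsub_lifts in Hf'.
           eapply bounded_step_onep; [exact Hf' | apply bounded_sub, HP].
        -- eapply bounded_step_onep; [exact HQ' | apply bounded_sub, HQ].
  - rewrite <- (fsub_id (sim_out late P Q)). unfold sim_out, all, ex, nab.
    apply der_all. intros S1 q1 X. apply der_all. intros S2 q2 P'.
    apply der_imp with (n := Datatypes.S n);
      [apply bounded_procs_onep; simp_sub; apply bounded_sub; auto |].
    intros S3 q3 Hf. simp_at Hf. destruct (H4 _ _ _ _ Hf) as (Q' & HQ' & HB).
    apply der_ex with (N := Q'). apply der_and.
    + simp_sub. apply der_step_onep. auto.
    + apply der_nab. cbn [fsub]. rewrite bisim_atom_sub. simp_sub.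
      rewrite !tsub_up_wk. simp_sub.
      apply (IHn S3 (tn :: l)).
      * exact (bounded_step_onep_wk Hf (bounded_sub _ HP)).
      * exact (bounded_step_onep_wk HQ' (bounded_sub _ HQ)).
      * exact HB.
Qed.

Lemma der_bisim late n : forall S l (P Q : tm (l ++ S) tp),
  bounded n P -> bounded n Q -> bisim late S l P Q ->
  der D_bisim [] (l ▷ fatom (bisim_atom late P Q)).
Proof.
  induction n as [| n IHn]; intros S l P Q HP HQ HB; [destruct (bounded_0 HP) |].
  assert (Hr : exists r : sub (cl_vars (bisim_clause late)) (l ++ S),
    asub r (cl_head (bisim_clause late)) = bisim_atom late P Q /\
    fsub r (cl_body (bisim_clause late)) = sim_body late P Q).
  { rewrite bisim_clause_eq. exists (scons P (scons Q (nosub _))). split.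
    - destruct late; reflexivity.
    - exact (sim_body_sub late (scons P (scons Q (nosub _))) (tvar vz) (tvar (vs vz))). }
  destruct Hr as (r & Hh & Hb).
  apply der_fold with (c := bisim_clause late) (r := r).
  - destruct late; unfold D_bisim; auto.
  - rewrite Hh. apply aconv_refl.
  - rewrite Hb. destruct HB as [HB1 HB2].
    destruct (der_half IHn HP HQ HB1) as (? & ? & ?).
    destruct (der_half IHn HQ HP HB2) as (? & ? & ?).
    repeat apply d_andR; auto.
Qed.

(** * Injectivity of the constants up to conversion *)

Inductive whred G : forall t, tm G t -> tm G t -> Prop :=
| whred_beta : forall a b (M : tm (a :: G) b) N,
    whred (tlam M ⋅ N) (tsub (scons N (@idsub G)) M)
| whred_app : forall a b (M M' : tm G (a ~> b)) N, whred M M' -> whred (M ⋅ N) (M' ⋅ N).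

Inductive whreds G t (M : tm G t) : tm G t -> Prop :=
| whreds_refl : whreds M M
| whreds_step : forall M' N, whred M M' -> whreds M' N -> whreds M N.

(* Arguments are compared by conversion only: that is all that injectivity of
   the constants needs. *)
Inductive neutral_eq G : forall t, tm G t -> tm G t -> Prop :=
| neutral_eq_var : forall t (x : var G t), neutral_eq (tvar x) (tvar x)
| neutral_eq_cst : forall t (c : cst t), neutral_eq (tcst c) (tcst c)
| neutral_eq_app : forall a b (M M' : tm G (a ~> b)) N N',
    neutral_eq M M' -> conv N N' -> neutral_eq (M ⋅ N) (M' ⋅ N').

Lemma whred_det G t (M N : tm G t) : whred M N -> forall N', whred M N' -> N = N'.
Proof.
  induction 1; intros N' H'.
  - dependent destruction H'; auto. dependent destruction H'.
  - dependent destruction H'.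
    + dependent destruction H.
    + f_equal. auto.
Qed.

Lemma neutral_eq_sym G t (M N : tm G t) : neutral_eq M N -> neutral_eq N M.
Proof. induction 1; constructor; auto using conv_sym. Qed.

Lemma neutral_eq_trans G t (M N : tm G t) :
  neutral_eq M N -> forall K, neutral_eq N K -> neutral_eq M K.
Proof.
  induction 1; intros K HK; auto. dependent destruction HK.
  constructor; auto. eapply conv_trans; eauto.
Qed.

Lemma neutral_eq_whred G t (M N : tm G t) : neutral_eq M N -> forall K, ~ whred M K.
Proof.
  induction 1; intros K HK; dependent destruction HK.
  - dependent destruction H.
  - eapply IHneutral_eq; eauto.
Qed.

Lemma whred_conv G t (M N : tm G t) : whred M N -> conv M N.
Proof. induction 1; [apply conv_beta | apply conv_app; auto using conv_refl]. Qed.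

Lemma neutral_eq_conv G t (M N : tm G t) : neutral_eq M N -> conv M N.
Proof. induction 1; auto using conv_refl, conv_app. Qed.

Lemma whreds_conv G t (M N : tm G t) : whreds M N -> conv M N.
Proof. induction 1; [apply conv_refl | eapply conv_trans; eauto using whred_conv]. Qed.

Lemma conv_tren G t (M N : tm G t) : conv M N -> forall D (r :
  ren G D), conv (tren r M) (tren r N).
Proof. intros. rewrite !tren_sub. apply conv_tsub; auto. Qed.

Lemma whred_tren G t (M N : tm G t) : whred M N ->
  forall D (r : ren G D), whred (tren r M) (tren r N).
Proof.
  induction 1; intros; cbn.
  - rewrite tren_tsub.
    match goal with |- whred (tlam ?X ⋅ ?Y) ?Z =>
      replace Z with (tsub (scons Y (@idsub _)) X); [constructor |] end.
    rewrite tsub_tren. f_equal. apply sub_ext_cons; auto.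
  - constructor; auto.
Qed.

Lemma whreds_tren G t (M N : tm G t) D (r : ren G D) : whreds M N -> whreds (tren r M) (tren r N).
Proof. induction 1; econstructor; eauto using whred_tren. Qed.

Lemma neutral_eq_tren G t (M N : tm G t) : neutral_eq M N -> forall D (r :
  ren G D), neutral_eq (tren r M) (tren r N).
Proof. induction 1; intros; cbn; constructor; auto using conv_tren. Qed.

(** * A Kripke logical relation for conversion *)

Definition logrel_base t G (M N : tm G t) : Prop :=
  exists M' N', whreds M M' /\ whreds N N' /\ neutral_eq M' N'.

(** Renamings are quantified over at arrow types so that two functions can be compared at a fresh
    variable, as eta requires. *)
Fixpoint logrel (t : ty) G : tm G t -> tm G t -> Prop :=
  match t return tm G t -> tm G t -> Prop with
  | a ~> b => fun M N => forall D (r : ren G D) (A B : tm D a),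
      logrel A B -> logrel (tren r M ⋅ A) (tren r N ⋅ B)
  | t => @logrel_base t G
  end.
Arguments logrel {t G} M N.

Lemma logrel_whred_l t : forall G (M M' N : tm G t), whred M M' -> logrel M' N -> logrel M N.
Proof.
  induction t; cbn; intros G M M' N H;
  try (intros (A & B & ? & ? & ?); exists A, B; split; auto; econstructor; eauto; fail).
  intros HL D r A B HA. eapply IHt2; [apply whred_app, whred_tren, H | auto].
Qed.

Lemma logrel_sym t : forall G (M N : tm G t), logrel M N -> logrel N M.
Proof.
  induction t; cbn; intros G M N;
  try (intros (A & B & ? & ? & ?); exists B, A; auto using neutral_eq_sym; fail).
  auto.
Qed.

Lemma logrel_whred_r t G (M N N' : tm G t) : whred N N' -> logrel M N' -> logrel M N.
Proof. intros. eapply logrel_sym, logrel_whred_l, logrel_sym; eauto. Qed.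

Lemma whreds_neutral_eq_det G t (M A B : tm G t) : whreds M A -> whreds M B ->
  (forall K, ~ whred A K) -> (forall K, ~ whred B K) -> A = B.
Proof.
  intros HA. revert B. induction HA; intros B HB H1 H2; destruct HB; auto.
  - exfalso; eapply H1; eauto.
  - exfalso; eapply H2; eauto.
  - rewrite (whred_det H H0) in *. auto.
Qed.

Lemma logrel_trans t : forall G (M N K : tm G t), logrel M N -> logrel N K -> logrel M K.
Proof.
  induction t; cbn; intros G M N K;
  try (intros (A & B & HM & HN & HAB) (B' & C & HN' & HK & HBC);
    assert (B = B') as <- by
      (eapply whreds_neutral_eq_det; eauto; eauto using neutral_eq_whred, neutral_eq_sym);
    exists A, C; eauto using neutral_eq_trans; fail).
  intros H1 H2 D r A B HA. eapply IHt2; [apply H1, HA | apply H2].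
  (* [B] is related to itself by way of [A]; reflexivity for all terms is only obtained later, from
     [logrel_fund]. *)
  eapply IHt1; [apply logrel_sym, HA | exact HA].
Qed.

(** The two halves need each other at arrow types: comparing functions uses that a fresh variable is
    related to itself, and relating applications of neutral terms uses that related arguments are
    convertible. *)
Lemma logrel_reify_reflect t : forall G,
  (forall M N : tm G t, logrel M N -> conv M N) /\ (forall M N :
  tm G t, neutral_eq M N -> logrel M N).
Proof.
  induction t; intros G; cbn; split; intros M N;
  try (intros (A & B & ? & ? & ?); eapply conv_trans; [eapply whreds_conv; eassumption |];
    eapply conv_trans; [eapply neutral_eq_conv; eassumption | apply conv_sym, whreds_conv;
    assumption]);
  try (intros; exists M, N; repeat split; auto; apply whreds_refl).
  - intros H. eapply conv_trans; [apply conv_eta |].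
    eapply conv_trans; [| apply conv_sym, conv_eta]. apply conv_lam.
    apply (IHt2 (t1 :: G)). apply H. apply (IHt1 (t1 :: G)). apply neutral_eq_var.
  - intros H D r A B HA. apply IHt2.
    apply neutral_eq_app; [apply neutral_eq_tren, H | apply IHt1, HA].
Qed.

Lemma logrel_tren t : forall G (M N : tm G t) D (r :
  ren G D), logrel M N -> logrel (tren r M) (tren r N).
Proof.
  destruct t; cbn; intros G M N D r H;
  try (destruct H as (A & B & ? & ? & ?); exists (tren r A), (tren r B);
    auto using whreds_tren, neutral_eq_tren; fail).
  intros E q A B HA. rewrite !tren_tren. auto.
Qed.

Definition logrel_sub G D (s s' : sub G D) : Prop := forall t x, logrel (s t x) (s' t x).

Lemma logrel_sub_scons a G D (M N : tm D a) (s s' : sub G D) :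
  logrel M N -> logrel_sub s s' -> logrel_sub (scons M s) (scons N s').
Proof. intros HM Hs. intro.
  apply (var_case (fun t x => logrel (scons M s x) (scons N s' x))); auto. Qed.

Lemma beta_tren G D E a b (M : tm (a :: G) b) (s : sub G D) (r : ren D E) A :
  tsub (scons A (@idsub E)) (tren (up_ren r) (tsub (up s) M)) =
  tsub (scons A (fun t x => tren r (s t x))) M.
Proof.
  rewrite tren_tsub, tsub_tsub. f_equal. apply sub_ext_cons; auto.
  intros t x. unfold scomp. cbn. unfold wk. rewrite tren_tren, tsub_tren, tren_sub. reflexivity.
Qed.

Lemma logrel_fund G t (M : tm G t) : forall D (s s' : sub G D),
  logrel_sub s s' -> logrel (tsub s M) (tsub s' M).
Proof.
  induction M; intros D s s' Hs; cbn [tsub].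
  - apply Hs.
  - apply logrel_reify_reflect, neutral_eq_cst.
  - specialize (IHM1 D s s' Hs D (fun _ x => x) _ _ (IHM2 D s s' Hs)).
    rewrite !(tren_sub (fun _ x => x)), !tsub_id in IHM1. exact IHM1.
  - intros E r A B HA. cbn [tren].
    eapply logrel_whred_l; [apply whred_beta |]. eapply logrel_whred_r; [apply whred_beta |].
    rewrite !beta_tren. apply IHM. apply logrel_sub_scons; auto. intros u x.
    apply logrel_tren, Hs.
Qed.

Lemma logrel_sub_refl_l G D (s s' : sub G D) : logrel_sub s s' -> logrel_sub s s.
Proof. intros H t x. eapply logrel_trans; [apply H | apply logrel_sym, H]. Qed.

Lemma logrel_conv G t (M N : tm G t) : conv M N ->
  forall D (s s' : sub G D), logrel_sub s s' -> logrel (tsub s M) (tsub s' N).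
Proof.
  induction 1; intros D s s' Hs.
  - apply logrel_fund; auto.
  - apply logrel_sym, IHconv. intros t' x. apply logrel_sym, Hs.
  - eapply logrel_trans; [apply IHconv1, (logrel_sub_refl_l Hs) | apply IHconv2, Hs].
  - cbn. specialize (IHconv1 D s s' Hs D (fun _ x => x) _ _ (IHconv2 D s s' Hs)).
    rewrite !(tren_sub (fun _ x => x)), !tsub_id in IHconv1. exact IHconv1.
  - intros E r A B HA. cbn [tren].
    eapply logrel_whred_l; [apply whred_beta |]. eapply logrel_whred_r; [apply whred_beta |].
    rewrite !beta_tren. apply IHconv. apply logrel_sub_scons; auto. intros u x.
    apply logrel_tren, Hs.
  - cbn. eapply logrel_whred_l; [apply whred_beta |].
    rewrite !tsub_tsub, up_scons, scomp_scons, scomp_idl, scomp_idr.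
    apply logrel_fund. apply logrel_sub_scons; auto. apply logrel_fund; auto.
  - intros E r A B HA. cbn [tsub tren]. eapply logrel_whred_r; [apply whred_beta |].
    cbn [tsub]. rewrite beta_tren, tsub_wk, <- tren_tsub.
    exact (logrel_fund M Hs E r A B HA).
Qed.

Lemma conv_logrel G t (M N : tm G t) : conv M N -> logrel M N.
Proof.
  intros H. rewrite <- (tsub_id M), <- (tsub_id N). apply logrel_conv; auto.
  intros u x. apply logrel_reify_reflect, neutral_eq_var.
Qed.

(** [neutral_eq M M] expresses that the head of [M] is a variable or a constant. Such a term has no
    weak head reduct, so the normal forms supplied by the logical relation are [M] and [N]
    themselves. *)
Lemma neutral_eq_of_conv G t (M N : tm G t) : (t = tp \/ t = ta) ->
  neutral_eq M M -> neutral_eq N N -> conv M N -> neutral_eq M N.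
Proof.
  intros Ht HM HN H. apply conv_logrel in H.
  assert (logrel_base M N) as (A & B & HA & HB & HAB) by (destruct Ht; subst; exact H).
  assert (M = A) as -> by (eapply whreds_neutral_eq_det; [apply whreds_refl | | |];
    eauto using neutral_eq_whred).
  assert (N = B) as -> by (eapply whreds_neutral_eq_det; [apply whreds_refl | | |];
    eauto using neutral_eq_whred, neutral_eq_sym).
  auto.
Qed.

Ltac constant_injectivity := intros H; apply neutral_eq_of_conv in H;
  auto 20 using neutral_eq, conv_refl;
  repeat match goal with H : neutral_eq _ _ |- _ => dependent destruction H end; auto.

Lemma tau_inj G (P P' : tm G tp) : conv (TauP P) (TauP P') -> conv P P'.
Proof. constant_injectivity. Qed.
Lemma plus_inj G (P P' Q Q' : tm G tp) :
  conv (Plus P Q) (Plus P' Q') -> conv P P' /\ conv Q Q'.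
Proof. constant_injectivity. Qed.
Lemma par_inj G (P P' Q Q' : tm G tp) :
  conv (Par P Q) (Par P' Q') -> conv P P' /\ conv Q Q'.
Proof. constant_injectivity. Qed.
Lemma match_inj G x x' y y' (P P' : tm G tp) :
  conv (Match x y P) (Match x' y' P') -> conv x x' /\ conv y y' /\ conv P P'.
Proof. constant_injectivity. Qed.
Lemma out_inj G x x' y y' (P P' : tm G tp) :
  conv (Out x y P) (Out x' y' P') -> conv x x' /\ conv y y' /\ conv P P'.
Proof. constant_injectivity. Qed.
Lemma in_inj G x x' (M M' : tm G (tn ~> tp)) :
  conv (Inp x M) (Inp x' M') -> conv x x' /\ conv M M'.
Proof. constant_injectivity. Qed.
Lemma nu_inj G (M M' : tm G (tn ~> tp)) : conv (Nu M) (Nu M') -> conv M M'.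
Proof. constant_injectivity. Qed.
Lemma up_inj G (x x' y y' : tm G tn) :
  conv (Up x ⋅ y) (Up x' ⋅ y') -> conv x x' /\ conv y y'.
Proof. constant_injectivity. Qed.

(** * Late and early bisimilarity *)

(* When [s] replaces a variable h by a term without h and fixes the other
   variables, [invariant s M] says that [M] does not depend on h. *)
Definition invariant G (s : sub G G) t (M : tm G t) : Prop := conv (tsub s M) M.

Lemma invariant_conv G (s : sub G G) t (M N : tm G t) :
  conv M N -> invariant s M -> invariant s N.
Proof.
  unfold invariant. intros H HM. eapply conv_trans; [apply conv_tsub, conv_sym, H |].
  eapply conv_trans; eauto.
Qed.

Lemma eta_inj G a b (M N : tm G (a ~> b)) :
  conv (tlam (⇑M ⋅ tvar vz)) (tlam (⇑N ⋅ tvar vz)) -> conv M N.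
Proof.
  intros H. eapply conv_trans; [apply conv_eta |]. eapply conv_trans; [exact H |].
  apply conv_sym, conv_eta.
Qed.

Lemma app_wk_inj G a b (M N : tm G (a ~> b)) :
  conv (⇑M ⋅ tvar vz) (⇑N ⋅ tvar vz) -> conv M N.
Proof. intros H. apply eta_inj, conv_lam, H. Qed.

(* [x] is needed because a type such as tn may have no closed inhabitant. *)
Lemma wk_inj G a t (x : tm G a) (M N : tm G t) : conv (⇑M : tm (a :: G) t) ⇑N -> conv M N.
Proof.
  intros H. apply conv_tsub with (s := scons x (@idsub G)) in H.
  rewrite !tsub_wk, !tsub_id in H. exact H.
Qed.

(** Semantic form of the fact that the free names of label and target occur in the source. Inputs
    yield abstractions, hence bring in no name. Labels are included because free communication
    instantiates an input at a name that is controlled only through the label of the output. *)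
Fixpoint preserves_invariant G (B : form G) D (s : sub D D) (r : sub G D) {struct B} : Prop :=
  match B with
  | fatom (one P A Q) => invariant s (tsub r P) ->
  invariant s (tsub r A) /\ invariant s (tsub r Q)
  | fatom (onep P A M) => invariant s (tsub r P) ->
  invariant s (tsub r A) /\ invariant s (tsub r M)
  | fand B C => preserves_invariant B s r /\ preserves_invariant C s r
  | @fex _ t B => exists N : tm D t, preserves_invariant B s (scons N r)
  | @fnab _ t B => preserves_invariant B (up s) (up r)
  | _ => True
  end.

Ltac conv_congr := repeat first
  [ assumption | apply conv_refl | apply conv_app | apply conv_lam | apply conv_wk ].

Ltac conv_invert := repeat match goal with
  | H : _ /\ _ |- _ => destruct H
  | H : exists _, _ |- _ => destruct H
  | H : conv (TauP _) (TauP _) |- _ => apply tau_inj in H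
  | H : conv (Plus _ _) (Plus _ _) |- _ => apply plus_inj in H
  | H : conv (Par _ _) (Par _ _) |- _ => apply par_inj in H
  | H : conv (Match _ _ _) (Match _ _ _) |- _ => apply match_inj in H
  | H : conv (Out _ _ _) (Out _ _ _) |- _ => apply out_inj in H
  | H : conv (Inp _ _) (Inp _ _) |- _ => apply in_inj in H
  | H : conv (Nu _) (Nu _) |- _ => apply nu_inj in H
  | H : conv (Up _ ⋅ _) (Up _ ⋅ _) |- _ => apply up_inj in H
  | H : conv (tlam (⇑_ ⋅ tvar vz)) (tlam (⇑_ ⋅ tvar vz)) |- _ => apply eta_inj in H
  | H : conv (⇑_ ⋅ tvar vz) (⇑_ ⋅ tvar vz) |- _ => apply app_wk_inj in H
  | x : tm ?G ?a, H : @conv (?a :: ?G) _ ⇑_ ⇑_ |- _ => apply (wk_inj x) in H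
  | H : conv _ _ -> _ |- _ => lapply H; [clear H; intro H | solve [conv_congr]]
  end.

(** Injectivity splits the invariance of the source into that of its components, which triggers the
    implications given by the body; congruence then reassembles label and target. The name [x]
    serves to strip a weakening in the clauses with nabla. *)
Lemma D_pi_invariant c : In c D_pi -> forall D (x : tm D tn) (s : sub D D) (r :
  sub (cl_vars c) D),
  preserves_invariant (cl_body c) s r -> preserves_invariant (fatom (cl_head c)) s r.
Proof.
  revert c. apply (proj1 (Forall_forall (fun c =>
    forall D (x : tm D tn) (s : sub D D) (r : sub (cl_vars c) D),
    preserves_invariant (cl_body c) s r -> preserves_invariant (fatom (cl_head c)) s r) D_pi)).
  unfold D_pi. repeat apply Forall_cons; [.. | apply Forall_nil];
    unfold mk_clause, nab, ex, lam; intros D x s r; cbn -[wk up invariant];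
    unfold invariant; cbn [tsub]; rewrite ?tsub_up_wk; cbn [tsub]; rewrite ?tsub_up_wk;
    cbn [tsub up scons].
  all: intros H Hc; conv_invert; try (split; conv_congr).
Qed.

Lemma holds_preserves_invariant G (B : form G) D (r : sub G D) : holds B r ->
  forall (x : tm D tn) (s : sub D D), preserves_invariant B s r.
Proof.
  induction 1; intros x q; cbn [preserves_invariant]; auto.
  - exists N. auto.
  - apply IHholds. exact (⇑x).
  - pose proof (@D_pi_invariant c H D x q r (IHholds x q)) as Hi.
    apply aconv_inv in H0. destruct A, (cl_head c); cbn in *; try contradiction; auto;
    destruct H0 as (HP & HA & HQ); intros HI; destruct Hi as [? ?];
      try (eapply invariant_conv; eassumption); split;
      eapply invariant_conv; try eassumption; apply conv_sym; assumption.
Qed.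

Lemma step_onep_invariant G (s : sub G G) (x : tm G tn) P A M :
  step_onep P A M -> invariant s P -> invariant s M.
Proof.
  intros H HP. pose proof (@holds_preserves_invariant _ _ _ _ H x s) as Hi. cbn in Hi.
  rewrite !tsub_id in Hi. tauto.
Qed.

(** A late answer is given before the name [w]; transported along [s'], it answers for every [w]. *)
Lemma half_early n S l (P Q : tm (l ++ S) tp) :
  (forall S l (P Q : tm (l ++ S) tp), bounded n P -> bounded n Q ->
    bisim true S l P Q -> bisim false S l P Q) ->
  bounded (Datatypes.S n) P -> bounded (Datatypes.S n) Q ->
  simulates true (@bisim true) S l P Q -> simulates false (@bisim false) S l P Q.
Proof.
  intros IH HP HQ (H1 & H2 & _ & H4). split; [| split; [discriminate | split]].
  - intros S' s A P' HT. destruct (H1 _ _ _ _ HT) as (Q' & HT' & HB).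
    exists Q'. split; auto. apply IH; auto.
    + eapply bounded_step_one; [exact HT | apply bounded_sub, HP].
    + eapply bounded_step_one; [exact HT' | apply bounded_sub, HQ].
  - intros _ S' s X M HT S'' s' w. destruct (H2 eq_refl _ _ _ _ HT) as (N & HT' & HB).
    apply (step_onep_sub (lifts l s')) in HT, HT'. rewrite !tsub_lifts in HT, HT'. cbn in HT, HT'.
    exists (tsub (lifts l s') N). split; auto. apply IH; auto.
    + eapply bounded_step_onep; [exact HT | apply bounded_sub, HP].
    + eapply bounded_step_onep; [exact HT' | apply bounded_sub, HQ].
  - intros S' s X M HT. destruct (H4 _ _ _ _ HT) as (N & HT' & HB).
    exists N. split; auto. apply (IH S' (tn :: l)); auto.
    + exact (bounded_step_onep_wk HT (bounded_sub _ HP)).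
    + exact (bounded_step_onep_wk HT' (bounded_sub _ HQ)).
Qed.

(* The generic name is [app_loc l vz], for a fresh variable [vz]; [d] maps it to
   the subject [X] of the action, a name that is always at hand. *)
Lemma half_late n S l (P Q : tm (l ++ S) tp) :
  (forall S l (P Q : tm (l ++ S) tp), bounded n P -> bounded n Q ->
    bisim false S l P Q -> bisim true S l P Q) ->
  bounded (Datatypes.S n) P -> bounded (Datatypes.S n) Q ->
  simulates false (@bisim false) S l P Q -> simulates true (@bisim true) S l P Q.
Proof.
  intros IH HP HQ (H1 & _ & H3 & H4). split; [| split; [| split; [discriminate |]]].
  - intros S' s A P' HT. destruct (H1 _ _ _ _ HT) as (Q' & HT' & HB).
    exists Q'. split; auto. apply IH; auto.
    + eapply bounded_step_one; [exact HT | apply bounded_sub, HP].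
    + eapply bounded_step_one; [exact HT' | apply bounded_sub, HQ].
  - intros _ S' s X M HT.
    set (h := @wksub S' (raise l tn)).
    set (d := scons (raise_lam l X) (@idsub S')).
    destruct (H3 eq_refl _ _ _ _ HT _ h (app_loc l vz)) as (N1 & HT' & HB).
    set (N := tsub (lifts l d) N1).
    assert (Hhd : scomp h d = @idsub S') by apply wk_scons.
    (* [scomp d h] replaces the generic name by [X] and fixes everything that comes from [S']. The
       answering process comes from [S'], so it is invariant, and so is its continuation [N1], which
       is therefore the weakening of [N]. *)
    assert (HN : conv (tsub (lifts l h) N) N1).
    { unfold N. rewrite tsub_lifts.
      apply (step_onep_invariant (s := lifts l (scomp d h)) (app_loc l vz) HT').
      unfold invariant. rewrite tsub_lifts.
      replace (scomp (scomp s h) (scomp d h)) with (scomp s h); [apply conv_refl |].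
      rewrite scomp_assoc, <- (scomp_assoc h), Hhd. reflexivity. }
    exists N. split.
    { apply (step_onep_sub (lifts l d)) in HT'. cbn in HT'. rewrite !tsub_lifts in HT'.
      rewrite scomp_assoc, Hhd, scomp_idr, lifts_id, tsub_id in HT'. exact HT'. }
    (* Bisimilarity at the generic name is transported along [e], which sends that name to the
       actual [w] and acts as [s'] elsewhere. *)
    intros S'' s' w. set (e := scons (raise_lam l w) s').
    assert (Hhe : scomp h e = s') by apply wk_scons.
    apply (@bisim_sub _ _ l _ _ _ e) in HB. cbn [tsub] in HB.
    rewrite tsub_lifts, Hhe in HB.
    assert (Hw : conv (tsub (lifts l e) (app_loc l vz)) w)
      by (rewrite tsub_app_loc; apply raise_app_raise_lam).
    assert (HNe : conv (tsub (lifts l e) N1) (tsub (lifts l s') N)).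
    { rewrite <- Hhe, <- tsub_lifts. apply conv_tsub, conv_sym, HN. }
    assert (Hb : bounded n (tsub (lifts l s') M ⋅ w)).
    { apply (step_onep_sub (lifts l s')) in HT.
      eapply bounded_step_onep; [exact HT | apply bounded_sub, bounded_sub, HP]. }
    assert (Hb' : bounded n (tsub (lifts l s') N ⋅ w)).
    { apply (step_onep_sub (lifts l e)) in HT'.
      eapply bounded_conv; [apply conv_app; [exact HNe | apply conv_refl] |].
      eapply bounded_step_onep; [exact HT' | apply bounded_sub, bounded_sub, HQ]. }
    apply IH; auto.
    eapply bisim_conv; [| | exact HB]; apply conv_app; auto using conv_refl.
  - intros S' s X M HT. destruct (H4 _ _ _ _ HT) as (N & HT' & HB).
    exists N. split; auto. apply (IH S' (tn :: l)); auto.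
    + exact (bounded_step_onep_wk HT (bounded_sub _ HP)).
    + exact (bounded_step_onep_wk HT' (bounded_sub _ HQ)).
Qed.

Lemma bisim_late_early n : forall S l (P Q : tm (l ++ S) tp),
  bounded n P -> bounded n Q -> (bisim true S l P Q <-> bisim false S l P Q).
Proof.
  induction n as [| n IHn]; intros S l P Q HP HQ; [destruct (bounded_0 HP) |].
  split; intros [HB1 HB2]; constructor;
    (eapply half_early || eapply half_late); eauto; intros; apply IHn; auto.
Qed.

(** * Universal closure over the free names *)

Lemma der_close k : forall B : form (names k),
  @der D_bisim (names k) [] ([] ▷ B) -> provable D_bisim (close k B).
Proof.
  induction k; intros B HB; auto.
  assert (E : eigen (S := names k) [] B = B :> form (tn :: names k)).
  { unfold eigen. rewrite <- (fsub_id B) at 2. apply (f_equal (fun s => fsub s B)).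
    apply sub_ext_cons; auto. }
  apply IHk, d_allR.
  exact (eq_ind_r (fun C => @der D_bisim (tn :: names k) [] ([] ▷ C)) HB E).
Qed.

Lemma force_close k : forall B : form (names k),
  force (close k B) [] [] (@idsub []) -> force B (names k) [] (@idsub (names k)).
Proof.
  induction k; intros B HB; auto.
  (* The outermost remaining quantifier is instantiated, in the world extended by one name, with
     that new name itself. *)
  specialize (IHk _ HB (tn :: names k) (@wksub (names k) tn) (tvar vz)).
  eapply force_sconv; [| exact IHk].
  apply sconv_cons; intros; apply conv_refl.
Qed.

Lemma provable_bisim late k (P Q : proc k) :
  provable D_bisim (close k (fatom (bisim_atom late (enc P) (enc Q)))) <->
  bisim late (names k) [] (enc P) (enc Q).
Proof.
  split.
  - intros H. apply sound in H. specialize (H [] (@idsub []) (fun J HJ => match HJ with end)).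
    apply force_close in H. apply force_bisim_atom in H. rewrite !tsub_id in H. exact H.
  - intros H. destruct (size_enc P) as [m Hm], (size_enc Q) as [n Hn].
    apply der_close. apply (der_bisim (n := m + n)); auto.
    + eapply bounded_le; [| exact Hm]; lia.
    + eapply bounded_le; [| exact Hn]; lia.
Qed.

Theorem theorem5p13 (k : nat) (P Q : proc k)
    (Hnames : forall x : Fin.t k, free x P \/ free x Q) :
  provable D_bisim (close k (fatom (lbisim (enc P) (enc Q)))) <->
  provable D_bisim (close k (fatom (ebisim (enc P) (enc Q)))).
Proof.
  destruct (size_enc P) as [m Hm], (size_enc Q) as [n Hn].
  rewrite (provable_bisim true P Q), (provable_bisim false P Q).
  apply (bisim_late_early (n := m + n)).
  - eapply bounded_le; [| exact Hm]; lia.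
  - eapply bounded_le; [| exact Hn]; lia.
Qed.
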